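(* There is an algorithm that, given a stopwatch automaton $\mathbb{A}$ with bound $B_\mathbb{A}$ and alphabet $\Sigma$, a word $w\in\Sigma^*$, a letter $a\in\Sigma$ and $n\in\mathbb{N}$, rejects if there does not exist a word $v$ over $\Sigma$ of length $n$ such that $wv\in L(\mathbb{A})$, and otherwise computes such a word $v$ (of length $n$ with $wv\in L(\mathbb{A})$) with maximal $\#_a(v)$. It runs in time $O\big(\|\mathbb{A}\|^2\cdot B_\mathbb{A}\cdot(|w|+n)\big)$.
   Context: For a word $u=a_0\cdots a_{m-1}$ and a letter $a$, $\#_a(u)=|\{i<m\mid a_i=a\}|$. A (specific) stopwatch automaton is a tuple $\mathbb{A}=(Q,\Sigma,X,\lambda,\beta,\zeta,\Delta)$ where $Q$ is a finite set of states containing two distinguished states $\mathit{start}$ and $\mathit{accept}$; $\Sigma$ is a finite nonempty alphabet; $X$ is a finite set of stopwatches; $\lambda:Q\to\Sigma$; $\beta:X\to\mathbb{N}$ assigns each stopwatch its bound; $\zeta\subseteq X\times Q$ ($x$ is active in $q$ iff $(x,q)\in\zeta$); $\Delta$ is a finite set of transitions $(q,g,\alpha,q')$ with $g$ a guard and $\alpha$ an action. An assignment is $\xi:X\to\mathbb{N}$ with $\xi(x)\le\beta(x)$. Guards are Boolean circuits taking the binary encoding of an assignment (a block of $\lceil\log(\beta(x)+1)\rceil$ bits per stopwatch) and outputting one bit; actions are Boolean circuits mapping such encodings to encodings of numbers $v_x$, the resulting assignment being $x\mapsto\min\{v_x,\beta(x)\}$. Edges $(q,\xi)\stackrel{t}{\to}(q',\xi')$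 between nodes (state, assignment): either $t=0$ and some $(q,g,\alpha,q')\in\Delta$ has $\xi$ satisfying $g$ and $\alpha(\xi)=\xi'$; or $t>0$, $q=q'$, and $\xi'(x)=\min\{\xi(x)+t,\beta(x)\}$ for $x$ active in $q$, $\xi'(x)=\xi(x)$ otherwise. A computation is a sequence $(q_0,\xi_0)\stackrel{t_0}{\to}\cdots\stackrel{t_{\ell-1}}{\to}(q_\ell,\xi_\ell)$ with $q_i\ne\mathit{accept}$ for $i<\ell$; it is initial if $q_0=\mathit{start}$ and $\xi_0\equiv0$, accepting if $q_\ell=\mathit{accept}$, and reads $\lambda(q_0)^{t_0}\cdots\lambda(q_{\ell-1})^{t_{\ell-1}}$. $L(\mathbb{A})$ is the set of words read by initial accepting computations. The bound of $\mathbb{A}$ is $B_\mathbb{A}=\prod_{x\in X}(\beta(x)+1)$, and $\|\mathbb{A}\|$ is the length of a reasonable binary encoding of $\mathbb{A}$. *)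

(* Defs.v *)
From mathcomp Require Import all_boot.

Set Implicit Arguments.
Unset Strict Implicit.
Unset Printing Implicit Defensive.

(* Number of bits of a block storing a value in {0, ..., b}, i.e. the least k
   with b + 1 <= 2 ^ k. *)
Definition width (b : nat) : nat := up_log 2 b.+1.

(* The k-bit binary notation of m, most significant bit first. *)
Definition bin (k m : nat) : seq bool :=
  mkseq (fun i => odd (m %/ 2 ^ (k - i.+1))) k.

Definition bin_val (s : seq bool) : nat :=
  foldl (fun v (b : bool) => v.*2 + b) 0 s.

(* Self-delimiting encoding: the number of binary digits in unary, then the
   digits. *)
Definition enc_nat (m : nat) : seq bool :=
  nseq (width m) true ++ false :: bin (width m) m.

Definition enc_nats (s : seq nat) : seq bool :=
  flatten [seq enc_nat m | m <- size s :: s].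

(* A circuit is a straight-line program; the arguments of NOT, AND and OR gates
   are positions of earlier gates, the argument of an input gate is the
   position of an input bit. *)
Inductive gate : Type :=
| GConst of bool
| GIn of nat
| GNot of nat
| GAnd of nat & nat
| GOr of nat & nat.

(* Gate number i of a circuit with m inputs only refers to earlier gates. *)
Definition gate_ok (m i : nat) (g : gate) : bool :=
  match g with
  | GConst _ => true
  | GIn j => j < m
  | GNot j => j < i
  | GAnd j k | GOr j k => (j < i) && (k < i)
  end.

Record circuit (m k : nat) : Type := Circuit {
  gates : seq gate;
  outs : k.-tuple nat;
  gates_ok : all (fun p => gate_ok m p.1 p.2)
                 (zip (iota 0 (size gates)) gates);
  outs_ok : all (fun j => j < size gates) outs
}.

Definition gate_val (inp vals : seq bool) (g : gate) : bool :=
  match g with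
  | GConst b => b
  | GIn i => nth false inp i
  | GNot j => ~~ nth false vals j
  | GAnd j k => nth false vals j && nth false vals k
  | GOr j k => nth false vals j || nth false vals k
  end.

Definition gate_vals (inp : seq bool) (gs : seq gate) : seq bool :=
  foldl (fun vals g => rcons vals (gate_val inp vals g)) [::] gs.

Definition circuit_eval (m k : nat) (C : circuit m k) (inp : seq bool) :
    seq bool :=
  [seq nth false (gate_vals inp (gates C)) j | j <- outs C].

Record transition (nQ m : nat) : Type := Transition {
  t_src : 'I_nQ;
  t_guard : circuit m 1;
  t_action : circuit m m;
  t_dst : 'I_nQ
}.

(* The states, letters and stopwatches are initial segments of the natural
   numbers; the alphabet is nonempty since lambda start is a letter. The
   finite set Delta is given by an enumeration. *)
Record automaton : Type := Automaton {
  nQ : nat;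
  nS : nat;
  nX : nat;
  start : 'I_nQ;
  accept : 'I_nQ;
  lambda : 'I_nQ -> 'I_nS;
  beta : 'I_nX -> nat;
  zeta : 'I_nX -> 'I_nQ -> bool;
  nD : nat;
  Delta : 'I_nD -> transition nQ (\sum_(x < nX) width (beta x))
}.

Definition bound (A : automaton) : nat := \prod_(x < nX A) (beta x).+1.

Definition assignment (A : automaton) : Type :=
  {dffun forall x : 'I_(nX A), 'I_(beta x).+1}.

(* The assignment x |-> min (v x) (beta x). *)
Definition cap (A : automaton) (v : 'I_(nX A) -> nat) : assignment A :=
  [ffun x : 'I_(nX A) => inord (minn (v x) (beta x)) : 'I_(beta x).+1].

Definition assignment_bits (A : automaton) (xi : assignment A) : seq bool :=
  flatten [seq bin (width (beta x)) (xi x) | x <- enum 'I_(nX A)].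

(* The number v_x encoded by the block of x in a bit string. *)
Definition block_val (A : automaton) (s : seq bool) (x : 'I_(nX A)) : nat :=
  bin_val
    (nth [::] (reshape [seq width (beta y) | y <- enum 'I_(nX A)] s) x).

Definition guard_sat (A : automaton)
    (g : circuit (\sum_(x < nX A) width (beta x)) 1) (xi : assignment A) :
    bool :=
  circuit_eval g (assignment_bits xi) == [:: true].

Definition act (A : automaton)
    (al : circuit (\sum_(x < nX A) width (beta x))
                  (\sum_(x < nX A) width (beta x)))
    (xi : assignment A) : assignment A :=
  cap (block_val (circuit_eval al (assignment_bits xi))).

Definition elapse (A : automaton) (q : 'I_(nQ A)) (t : nat)
    (xi : assignment A) : assignment A :=
  cap (fun x => if zeta x q then xi x + t else xi x).

Definition node (A : automaton) : Type := ('I_(nQ A) * assignment A)%type.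

Inductive edge (A : automaton) : node A -> nat -> node A -> Prop :=
| edge_jump (d : 'I_(nD A)) (xi : assignment A) :
    guard_sat (t_guard (Delta d)) xi ->
    edge (t_src (Delta d), xi) 0
         (t_dst (Delta d), act (t_action (Delta d)) xi)
| edge_time (q : 'I_(nQ A)) (xi : assignment A) (t : nat) :
    0 < t -> edge (q, xi) t (q, elapse q t xi).

(* [computation c s]: with s = [:: (t_0, c_1); ...; (t_(l-1), c_l)], the
   sequence c -t_0-> c_1 ... -t_(l-1)-> c_l is a computation. *)
Fixpoint computation (A : automaton) (c : node A) (s : seq (nat * node A)) :
    Prop :=
  match s with
  | [::] => True
  | (t, c') :: s' =>
      [/\ c.1 <> accept A, edge c t c' & computation c' s']
  end.

Fixpoint word_read (A : automaton) (c : node A) (s : seq (nat * node A)) :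
    seq 'I_(nS A) :=
  match s with
  | [::] => [::]
  | (t, c') :: s' => nseq t (lambda c.1) ++ word_read c' s'
  end.

Definition lang (A : automaton) (w : seq 'I_(nS A)) : Prop :=
  let c0 : node A := (start A, cap (fun=> 0)) in
  exists s : seq (nat * node A),
    [/\ computation c0 s,
        (last c0 [seq p.2 | p <- s]).1 = accept A
      & word_read c0 s = w].

Definition gate_nats (g : gate) : seq nat :=
  match g with
  | GConst b => [:: 0; nat_of_bool b]
  | GIn i => [:: 1; i]
  | GNot j => [:: 2; j]
  | GAnd j k => [:: 3; j; k]
  | GOr j k => [:: 4; j; k]
  end.

Definition circuit_nats (m k : nat) (C : circuit m k) : seq nat :=
  size (gates C) :: flatten [seq gate_nats g | g <- gates C] ++ outs C.

Definition transition_nats (n m : nat) (d : transition n m) : seq nat :=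
  nat_of_ord (t_src d) :: nat_of_ord (t_dst d) ::
  circuit_nats (t_guard d) ++ circuit_nats (t_action d).

Definition automaton_nats (A : automaton) : seq nat :=
  [:: nQ A; nS A; nX A; nD A; nat_of_ord (start A); nat_of_ord (accept A)]
  ++ [seq nat_of_ord (lambda q) | q <- enum 'I_(nQ A)]
  ++ [seq beta x | x <- enum 'I_(nX A)]
  ++ [seq nat_of_bool (zeta x q) | x <- enum 'I_(nX A), q <- enum 'I_(nQ A)]
  ++ flatten [seq transition_nats (Delta d) | d <- enum 'I_(nD A)].

Definition automaton_code (A : automaton) : seq bool :=
  enc_nats (automaton_nats A).

Definition automaton_size (A : automaton) : nat := size (automaton_code A).

(* The machine is a RAM whose memory is split into arrays of natural numbers,
   named by the numbers occurring in the program text (so a program uses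
   finitely many of them); a scalar variable is an array used at index 0 only.
   The arithmetic is addition and truncated subtraction, control is
   structured, and each operator and each command costs one time unit. *)
Inductive expr : Type :=
| Const of nat
| Read of nat & expr
| Add of expr & expr
| Sub of expr & expr.

Inductive prog : Type :=
| Skip
| Store of nat & expr & expr      (* Store x i e is x[i] := e *)
| Seq of prog & prog
| If of expr & prog & prog        (* tests are "different from 0" *)
| While of expr & prog.

Definition memory : Type := nat -> nat -> nat.

Fixpoint expr_val (s : memory) (e : expr) : nat :=
  match e with
  | Const k => k
  | Read x e1 => s x (expr_val s e1)
  | Add e1 e2 => expr_val s e1 + expr_val s e2
  | Sub e1 e2 => expr_val s e1 - expr_val s e2
  end.

Fixpoint expr_cost (e : expr) : nat :=
  match e with
  | Const _ => 1
  | Read _ e1 => (expr_cost e1).+1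
  | Add e1 e2 | Sub e1 e2 => (expr_cost e1 + expr_cost e2).+1
  end.

Definition update (s : memory) (x i v : nat) : memory :=
  fun y j => if (y == x) && (j == i) then v else s y j.

(* [exec P s t s']: started in s, P halts in s' after t time units. *)
Inductive exec : prog -> memory -> nat -> memory -> Prop :=
| exec_skip s : exec Skip s 1 s
| exec_store s x i e :
    exec (Store x i e) s (expr_cost i + expr_cost e).+1
         (update s x (expr_val s i) (expr_val s e))
| exec_seq s s1 s2 P1 P2 t1 t2 :
    exec P1 s t1 s1 -> exec P2 s1 t2 s2 -> exec (Seq P1 P2) s (t1 + t2).+1 s2
| exec_if_true s s1 e P1 P2 t :
    expr_val s e != 0 -> exec P1 s t s1 ->
    exec (If e P1 P2) s (expr_cost e + t).+1 s1
| exec_if_false s s1 e P1 P2 t :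
    expr_val s e = 0 -> exec P2 s t s1 ->
    exec (If e P1 P2) s (expr_cost e + t).+1 s1
| exec_while_true s s1 s2 e P t1 t2 :
    expr_val s e != 0 -> exec P s t1 s1 -> exec (While e P) s1 t2 s2 ->
    exec (While e P) s (expr_cost e + t1 + t2).+1 s2
| exec_while_false s e P :
    expr_val s e = 0 -> exec (While e P) s (expr_cost e).+1 s.

(* The input bit string is in array 0, all other cells are 0. *)
Definition init_memory (inp : seq bool) : memory :=
  fun x i => if x == 0 then nat_of_bool (nth false inp i) else 0.

(* The answer is in array 1: cell 0 is 0 for rejection and 1 otherwise, in
   which case the letters of the output word are in cells 1, 2, ... *)
Definition rejects (s : memory) : Prop := s 1 0 = 0.

Definition outputs (k : nat) (s : memory) (v : seq 'I_k) : Prop :=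
  s 1 0 = 1 /\ [seq s 1 i.+1 | i <- iota 0 (size v)] = map val v.

Definition instance_code (A : automaton) (w : seq 'I_(nS A)) (a : 'I_(nS A))
    (n : nat) : seq bool :=
  automaton_code A ++ enc_nats (nat_of_ord a :: n :: map val w).

Definition extension (A : automaton) (w : seq 'I_(nS A)) (n : nat)
    (v : seq 'I_(nS A)) : Prop :=
  size v = n /\ lang (w ++ v).

Definition best_extension (A : automaton) (w : seq 'I_(nS A)) (a : 'I_(nS A))
    (n : nat) (v : seq 'I_(nS A)) : Prop :=
  extension w n v /\
  forall v', extension w n v' -> count_mem a v' <= count_mem a v.

(* Main.v *)
Require Import Defs.
From mathcomp Require Import all_boot zify.
From Stdlib Require Import FunctionalExtensionality.

(* Since time can be advanced in unit steps, wv is accepted iff the graph on the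
   configurations (j, (q, xi)), with j <= |w| + n the number of letters read,
   has a path from (0, start) to an accepting configuration of layer |w| + n
   that is labelled wv.  Give an edge the cost 1 if it reads a letter different
   from a at a position >= |w|, and 0 otherwise: a best v belongs to a cheapest
   path.  Such a path is found by a search with two stacks, one for the entries
   of the current cost d and one for those of cost d + 1; the first accepting
   entry of layer |w| + n that is popped is optimal, and v is read off by
   following the parent pointers.  There are (|w| + n + 1) * nQ * bound A
   configurations, each expanded once, in one pass over the code of A.  An
   assignment is represented by the number with its binary encoding, so that
   the table of visited configurations is an array that needs no
   initialisation. *)

Set Implicit Arguments.
Unset Strict Implicit.
Unset Printing Implicit Defensive.

(** * Hoare logic with a clock *)

(** The machine can only add and subtract, so every product is maintained incrementally: powers of
    two are tabulated, [j * nQ] is stored with each entry, and the table index of a successor is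
    built by doubling while its assignment is packed. Jumps read no letter, so a layer may contain
    cycles and no order of evaluation is known in advance; a search is needed inside each layer too.
    Two stacks suffice because an edge costs 0 or 1, so all pending entries cost d or d + 1.
    Successors are pushed without consulting the table, and an entry whose configuration was visited
    meanwhile is dropped when popped; such entries are paid for by the pushes, at most nD + 1 per
    visited configuration. The invariant does not mention distances. It only says that each edge
    leaving an expanded configuration has been relaxed ([covered]); induction along a path then
    shows that every path cheaper than the current cost ends in a configuration visited at no
    greater cost. *)

Fixpoint mods (P : prog) : seq nat :=
  match P with
  | Skip => [::]
  | Store x _ _ => [:: x]
  | Seq P1 P2 | If _ P1 P2 => mods P1 ++ mods P2
  | While _ P1 => mods P1
  end.

Definition setf (f : nat -> nat) (i v : nat) : nat -> nat :=
  fun j => if j == i then v else f j.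

Lemma setf_eq f i v : setf f i v i = v.
Proof. by rewrite /setf eqxx. Qed.

Lemma setf_neq f i v j : j != i -> setf f i v j = f j.
Proof. by rewrite /setf => /negbTE ->. Qed.

Lemma update_same s x i v : update s x i v x = setf (s x) i v.
Proof. by apply: functional_extensionality => j; rewrite /update eqxx. Qed.

Lemma update_other s x i v y : (y == x) = false -> update s x i v y = s y.
Proof. by move=> yx; apply: functional_extensionality => j; rewrite /update yx. Qed.

(** Framing is by whole arrays: it equates functions, and since arrays are named by numerals the
    side condition is decided by computation. *)
Definition framed (P : prog) (s s' : memory) : Prop :=
  forall y, (y \in mods P) = false -> s' y = s y.

Lemma exec_framed P s t s' : exec P s t s' -> framed P s s'.
Proof.
elim=> {P s t s'} //=.
- by move=> s x i e y; rewrite inE; apply: update_other.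
- move=> s s1 s2 P1 P2 t1 t2 _ IH1 _ IH2 y /=; rewrite mem_cat => /norP/= [/negbTE y1 /negbTE y2].
  by rewrite IH2 // IH1.
- by move=> s s1 e P1 P2 t _ _ IH y /=; rewrite mem_cat => /norP/= [/negbTE y1 _]; rewrite IH.
- by move=> s s1 e P1 P2 t _ _ IH y /=; rewrite mem_cat => /norP/= [_ /negbTE y2]; rewrite IH.
- by move=> s s1 s2 e P t1 t2 _ _ IH1 _ IH2 y y1; rewrite IH2 // IH1.
Qed.

(** Total correctness: a halting run is part of the definition. The postcondition sees the
    accumulated clock, so time bounds are proved along with correctness. *)
Definition wp (P : prog) (Q : nat -> memory -> Prop) (t : nat) (s : memory) : Prop :=
  exists t' s', exec P s t' s' /\ Q (t + t') s'.

Lemma wp_skip (Q : nat -> memory -> Prop) t s : Q t.+1 s -> wp Skip Q t s.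
Proof. by move=> q; exists 1, s; split; [constructor | rewrite addn1]. Qed.

Lemma wp_store x i e (Q : nat -> memory -> Prop) t s :
  Q (t + (expr_cost i + expr_cost e).+1) (update s x (expr_val s i) (expr_val s e)) ->
  wp (Store x i e) Q t s.
Proof. by move=> q; eexists; eexists; split; [constructor | exact: q]. Qed.

Lemma wp_seq P1 P2 (Q : nat -> memory -> Prop) t s :
  wp P1 (wp P2 Q) t.+1 s -> wp (Seq P1 P2) Q t s.
Proof.
case=> t1 [s1 [e1 [t2 [s2 [e2 q]]]]]; exists (t1 + t2).+1, s2; split.
  exact: exec_seq e1 e2.
by move: q; congr Q; lia.
Qed.

Lemma wp_if e P1 P2 (Q : nat -> memory -> Prop) t s :
  (expr_val s e != 0 -> wp P1 Q (t + (expr_cost e).+1) s) ->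
  (expr_val s e = 0 -> wp P2 Q (t + (expr_cost e).+1) s) ->
  wp (If e P1 P2) Q t s.
Proof.
move=> h1 h2; case: (eqVneq (expr_val s e) 0) => [e0|e0].
  case: (h2 e0) => t' [s' [ex q]]; exists (expr_cost e + t').+1, s'; split.
    exact: exec_if_false.
  by move: q; congr Q; lia.
case: (h1 e0) => t' [s' [ex q]]; exists (expr_cost e + t').+1, s'; split.
  exact: exec_if_true.
by move: q; congr Q; lia.
Qed.

(* Termination comes from the clock: each round advances it, and the invariant
   bounds it by [T]. *)
Lemma wp_while T (I : nat -> memory -> Prop) e P (Q : nat -> memory -> Prop) t s :
  I t s ->
  (forall t s, I t s -> t <= T) ->
  (forall t s, I t s -> expr_val s e != 0 -> wp P I (t + (expr_cost e).+1) s) ->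
  (forall t s, I t s -> expr_val s e = 0 -> Q (t + (expr_cost e).+1) s) ->
  wp (While e P) Q t s.
Proof.
move=> i0 IT IP IQ; have [k kP] := ubnP (T.+1 - t).
elim: k t s i0 kP => // k IH t s i0 kP.
case: (eqVneq (expr_val s e) 0) => [e0|e0].
  by exists (expr_cost e).+1, s; split; [constructor | apply: IQ].
case: (IP _ _ i0 e0) => t1 [s1 [x1 i1]].
have := IT _ _ i0; have := IT _ _ i1 => T1 T0.
case: (IH _ _ i1); first by lia.
move=> t2 [s2 [x2 q]]; exists (expr_cost e + t1 + t2).+1, s2; split.
  exact: exec_while_true x1 x2.
by move: q; congr Q; lia.
Qed.

(** The consequence rule hands over the frame condition, so that specifications need only speak of
    the arrays that are written. *)
Lemma wp_mono P (Q Q' : nat -> memory -> Prop) t s :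
  wp P Q t s -> (forall t' s', framed P s s' -> Q t' s' -> Q' t' s') ->
  wp P Q' t s.
Proof.
case=> t1 [s1 [x1 q1]] h; exists t1, s1; split=> //; apply: h => //.
exact: exec_framed x1.
Qed.

Notation Minus := Defs.Sub.

Notation "$ x" := (Read x (Const 0)) (at level 9, format "$ x").
Notation "x @ e" := (Read x e) (at level 10, only parsing).
Notation "x ::= e" := (Store x (Const 0) e) (at level 70).
Notation "P1 ;; P2" := (Seq P1 P2) (at level 80, right associativity).

(** The distance of the two values, since one of the truncated differences is 0. *)
Definition neq (e1 e2 : expr) : expr := Add (Minus e1 e2) (Minus e2 e1).

Definition For (i : nat) (e : expr) (P : prog) : prog :=
  i ::= Const 0 ;; While (Minus e $i) (P ;; i ::= Add $i (Const 1)).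

(** The bound [e] is evaluated again in each round, so the invariant has to fix its value. The clock
    offsets are exact: 4 for the initialisation, [expr_cost e + 5] for a successful test and the
    sequencing of the body, 6 for the increment, [expr_cost e + 4] for the failing test. *)
Lemma wp_for n (J : nat -> nat -> memory -> Prop) i e P
    (Q : nat -> memory -> Prop) t s T :
  J 0 t.+4 (update s i 0 0) ->
  (forall k t s, J k t s -> [/\ k <= n, s i 0 = k, expr_val s e = n & t <= T]) ->
  (forall k t s, k < n -> J k t s ->
     wp P (fun t' s' => J k.+1 (t' + 6) (update s' i 0 (s' i 0).+1))
        (t + (expr_cost e + 5)) s) ->
  (forall t s, J n t s -> Q (t + (expr_cost e + 4)) s) ->
  wp (For i e P) Q t s.
Proof.
move=> j0 jk jP jQ; apply: wp_seq; apply: wp_store => /=.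
have -> : t.+1 + (1 + 1).+1 = t.+4 by lia.
apply: (@wp_while T (fun t s => J (s i 0) t s)) => [|t1 s1 /jk[] //|t1 s1 j1 /= e1|t1 s1 j1 /= e1].
- by rewrite /update !eqxx.
- have [k1 _ k2 _] := jk _ _ _ j1; apply: wp_seq.
  have lt : s1 i 0 < n by lia.
  have := jP _ _ _ lt j1.
  have -> : t1 + (expr_cost e + 5) = (t1 + (expr_cost e + 2).+2).+1 by lia.
  move=> h; apply: wp_mono h _ => t2 s2 _ j2; apply: wp_store => /=.
  rewrite {1}/update !eqxx /=; have [_ + _ _] := jk _ _ _ j2.
  rewrite {1}/update !eqxx /= => e2; move: (j2); rewrite -e2.
  by rewrite addn1 (_ : t2 + _ = t2 + 6).
have [k1 _ k2 _] := jk _ _ _ j1.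
have E : s1 i 0 = n by lia.
have := jQ _ _ (eq_rect _ (fun k => J k t1 s1) j1 _ E).
by rewrite (_ : t1 + (expr_cost e + 4) = t1 + (expr_cost e + 2).+2) //; lia.
Qed.

Ltac mem_step :=
  match goal with
  | |- context [update ?s ?x ?i ?v ?y] =>
      first [ rewrite (@update_other s x i v y (erefl false))
            | rewrite (@update_same s x i v) ]
  end.
Ltac mem := repeat mem_step.
Ltac memr := mem; rewrite /= ?setf_eq /=.
Ltac spl :=
  repeat match goal with
  | |- _ /\ _ => split
  | |- and3 _ _ _ => split
  | |- and4 _ _ _ _ => split
  | |- and5 _ _ _ _ _ => split
  end.
Ltac fin := spl; memr; try done; try lia.
Ltac st := first [apply: wp_seq | apply: wp_store => /= | apply: wp_skip].
(* [h : y \notin ms] discharges the side conditions [(y == x) = false]. *)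
Ltac others y h :=
  rewrite ?update_other;
  try (by apply/negbTE; move: h; apply: contraNN => /eqP ->).

(** * Binary notation and segments of arrays *)

Lemma size_bin k m : size (bin k m) = k.
Proof. by rewrite size_mkseq. Qed.

Lemma binS k m : bin k.+1 m = rcons (bin k m./2) (odd m).
Proof.
rewrite /bin /mkseq (_ : iota 0 k.+1 = iota 0 k ++ [:: k]); last by rewrite -addn1 iotaD.
rewrite map_cat /= cats1 subnn expn0 divn1.
congr rcons; apply/eq_in_map => i; rewrite mem_iota add0n => /andP[_ ik].
have -> : k.+1 - i.+1 = (k - i.+1).+1 by lia.
by rewrite expnS -divn2 divnMA.
Qed.

Lemma bin_val_rcons s b : bin_val (rcons s b) = (bin_val s).*2 + b.
Proof. by rewrite /bin_val foldl_rcons. Qed.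

Lemma bin_val_cat s1 s2 : bin_val (s1 ++ s2) = bin_val s1 * 2 ^ size s2 + bin_val s2.
Proof.
elim/last_ind: s2 => [|s2 b IH]; first by rewrite cats0 muln1 addn0.
by rewrite -rcons_cat !bin_val_rcons IH size_rcons expnS -!mul2n; lia.
Qed.

Lemma bin_val_lt s : bin_val s < 2 ^ size s.
Proof.
elim/last_ind: s => [//|s b IH]; rewrite bin_val_rcons size_rcons expnS -mul2n.
by case: b; lia.
Qed.

Lemma bin_val_bin k m : m < 2 ^ k -> bin_val (bin k m) = m.
Proof.
elim: k m => [|k IH] m; first by rewrite expn0 ltnS leqn0 => /eqP ->.
rewrite expnS binS bin_val_rcons => mk; rewrite IH; last by lia.
by rewrite addnC odd_double_half.
Qed.

Lemma bin_bin_val s : bin (size s) (bin_val s) = s.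
Proof.
elim/last_ind: s => [//|s b IH]; rewrite size_rcons binS bin_val_rcons.
by rewrite oddD odd_double /= oddb addnC half_bit_double IH.
Qed.

Lemma bin_val_inj s1 s2 : size s1 = size s2 -> bin_val s1 = bin_val s2 -> s1 = s2.
Proof. by move=> ss bb; rewrite -(bin_bin_val s1) ss bb bin_bin_val. Qed.

Lemma ltn_width b : b < 2 ^ width b.
Proof. exact: up_logP. Qed.

Lemma leq_width b : width b <= b.
Proof. by apply: up_log_min => //; apply: ltn_expl. Qed.

Lemma width_mono : {homo width : b c / b <= c}.
Proof. by move=> b c bc; apply: leq_up_log. Qed.

Lemma size_enc_nat m : size (enc_nat m) = (2 * width m).+1.
Proof. by rewrite size_cat size_nseq /= size_bin; lia. Qed.

Definition at_ (f : nat -> nat) (p : nat) (l : seq nat) : Prop :=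
  forall i, i < size l -> f (p + i) = nth 0 l i.

Lemma at_cat f p l1 l2 : at_ f p (l1 ++ l2) <-> at_ f p l1 /\ at_ f (p + size l1) l2.
Proof.
split=> [h|[h1 h2] i]; first split=> i il.
- by rewrite h ?nth_cat ?il // size_cat; lia.
- rewrite -addnA h ?size_cat ?nth_cat; last by lia.
  by rewrite ltnNge leq_addr /= addKn.
rewrite size_cat nth_cat => il; case: ltnP => li; first exact: h1.
by rewrite -h2; [congr f; lia | lia].
Qed.

Lemma at_cons f p x l : at_ f p (x :: l) <-> f p = x /\ at_ f p.+1 l.
Proof.
rewrite -cat1s at_cat addn1; split=> [[h1 h2]|[h1 h2]]; split=> //.
  by have := h1 0 isT; rewrite addn0.
by case=> // _; rewrite addn0.
Qed.

Lemma at_setf f p l v : at_ f p l -> at_ (setf f (p + size l) v) p (rcons l v).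
Proof.
move=> h; rewrite -cats1 at_cat at_cons setf_eq; split=> // i il.
by rewrite setf_neq ?h //; lia.
Qed.

Lemma at_init inp : at_ (init_memory inp 0) 0 (map nat_of_bool inp).
Proof. by move=> i; rewrite size_map => ii; rewrite (nth_map false). Qed.

(** * Reading the input *)

Notation inp := 0 (only parsing).
Notation out := 1 (only parsing).
Notation num := 2 (only parsing).
Notation wd := 3 (only parsing).
Notation pos := 4 (only parsing).
Notation res := 5 (only parsing).
Notation cnt := 14 (only parsing).
Notation ii := 15 (only parsing).
Notation kk := 16 (only parsing).

Definition parse_num : prog :=
  cnt ::= Const 0 ;; res ::= Const 0 ;;
  While (inp @ $pos) (pos ::= Add $pos (Const 1) ;; cnt ::= Add $cnt (Const 1)) ;;
  pos ::= Add $pos (Const 1) ;;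
  For ii $cnt
    (res ::= Add (Add $res $res) (inp @ $pos) ;; pos ::= Add $pos (Const 1)).

(** Constant work per bit: the unary prefix gives the number of digits, which are then evaluated by
    Horner's rule. *)
Lemma wp_parse_num m p (Q : nat -> memory -> Prop) t s :
  s pos 0 = p -> at_ (s inp) p (map nat_of_bool (enc_nat m)) ->
  (forall t' s', framed parse_num s s' -> t' <= t + 70 * size (enc_nat m) ->
     s' res 0 = m -> s' pos 0 = p + size (enc_nat m) -> Q t' s') ->
  wp parse_num Q t s.
Proof.
move=> sp; rewrite /enc_nat; set k := width m.
rewrite map_cat map_nseq /= at_cat size_nseq at_cons => -[a1 [a2 a3]] h.
pose R t' s' := [/\ t' <= t + 70 * (2 * k).+1, s' res 0 = m & s' pos 0 = p + (2 * k).+1].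
suff: wp parse_num R t s.
  move=> w; apply: wp_mono w _ => t' s' fr [h1 h2 h3]; move: h.
  rewrite size_cat size_nseq /= size_bin (_ : k + k.+1 = (2 * k).+1); last by lia.
  by move=> h; apply: h.
apply: wp_seq; apply: wp_store => /=; apply: wp_seq; apply: wp_store => /=.
apply: wp_seq.
pose I t' s' := exists j, [/\ j <= k, s' pos 0 = p + j, s' cnt 0 = j /\ s' res 0 = 0,
  t' <= t + 10 + 30 * j & s' inp = s inp].
apply: (@wp_while (t + 10 + 30 * k) I).
- by exists 0; mem; rewrite sp addn0; split=> //; lia.
- by move=> t' s' [j [? _ _ ? _]]; lia.
- move=> t' s' [j [jk e1 [e2 e3] tj e4]] /=; rewrite e1 e4 => nz.
  have {}jk : j < k.
    case: ltnP => // kj; have E : j = k by lia.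
    by move: nz; rewrite E a2.
  apply: wp_seq; apply: wp_store => /=; apply: wp_store => /=; mem.
  exists j.+1; mem; rewrite /= !setf_eq e1 e2 e3; split=> //; lia.
move=> t' s' [j [jk e1 [e2 e3] tj e4]] /=; rewrite e1 e4 => z.
have {}jk : j = k.
  apply/eqP; rewrite eqn_leq jk leqNgt; apply/negP => lt.
  by have := a1 j; rewrite size_nseq nth_nseq lt z => /(_ isT).
subst j; apply: wp_seq; apply: wp_store => /=; rewrite e1.
pose J i t'' s'' := [/\ s'' ii 0 = i, s'' cnt 0 = k, s'' pos 0 = p + k + 1 + i /\ s'' inp = s inp,
  i <= k /\ s'' res 0 = bin_val (take i (bin k m)) & t'' <= t + 50 + 30 * k + 50 * i].
apply: (@wp_for k J _ _ _ _ _ _ (t + 50 + 80 * k)).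
- by rewrite /J; fin; rewrite ?e1 ?e2 ?e3 ?take0; fin.
- by move=> i t'' s'' [f1 f2 _ [? _] ?]; fin.
- move=> i t'' s'' lt [f1 f2 [f3 f3'] [f4 f5] f6]; apply: wp_seq; apply: wp_store => /=.
  apply: wp_store => /=; split; mem => //=; rewrite ?setf_eq ?f1 ?f2 ?f3 ?f5 ?f3' //.
  + by split=> //; lia.
  + split=> //; rewrite (take_nth false) ?size_bin // bin_val_rcons -addnn; congr (_ + _).
    have := a3 i; rewrite size_map size_bin => /(_ lt).
    by rewrite (nth_map false) ?size_bin // => <-; congr (s inp); lia.
  + by lia.
move=> t'' s'' [f1 f2 [f3 f3'] [f4 f5] f6]; split=> /=; rewrite ?f3; try lia.
by rewrite f5 take_oversize ?size_bin // bin_val_bin // ltn_width.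
Qed.

Notation tot := 17 (only parsing).
Notation jj := 18 (only parsing).

Definition parse_list (x : nat) : prog :=
  parse_num ;; tot ::= $res ;;
  For jj $tot (parse_num ;; Store x $jj $res).

(** The destination [x] is confined to two numerals so that its distinctness from the scratch arrays
    can be computed in each case. *)
Lemma wp_parse_list x l p (Q : nat -> memory -> Prop) t s :
  x \in [:: num; wd] ->
  s pos 0 = p -> at_ (s inp) p (map nat_of_bool (enc_nats l)) ->
  (forall t' s', framed (parse_list x) s s' -> t' <= t + 200 * size (enc_nats l) ->
     s' tot 0 = size l -> at_ (s' x) 0 l -> s' pos 0 = p + size (enc_nats l) -> Q t' s') ->
  wp (parse_list x) Q t s.
Proof.
move=> hx sp; rewrite /enc_nats /= map_cat size_cat at_cat size_map => -[a1 a2].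
set e0 := size (enc_nat _) in a2 *.
pose E i := size (flatten [seq enc_nat m | m <- take i l]).
have E0 : E 0 = 0 by rewrite /E take0.
have El : size (flatten [seq enc_nat m | m <- l]) = E (size l) by rewrite /E take_size.
have ES i : i < size l -> E i.+1 = E i + size (enc_nat (nth 0 l i)).
  by move=> il; rewrite /E (take_nth 0) // map_rcons flatten_rcons size_cat.
have e0p : 0 < e0 by rewrite /e0 size_enc_nat.
have step : forall i f, at_ f (p + e0) (map nat_of_bool (flatten [seq enc_nat m | m <- l])) ->
    i < size l -> at_ f (p + e0 + E i) (map nat_of_bool (enc_nat (nth 0 l i))).
  move=> i f + il; rewrite -{1}(cat_take_drop i l) map_cat flatten_cat map_cat at_cat.
  by case=> _; rewrite size_map (drop_nth 0) //= map_cat at_cat => -[].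
rewrite El => h.
pose R t' s' := [/\ t' <= t + 200 * (e0 + E (size l)), s' tot 0 = size l, at_ (s' x) 0 l
  & s' pos 0 = p + (e0 + E (size l))].
suff w : wp (parse_list x) R t s by apply: wp_mono w _ => t' s' fr []; apply: h.
apply: wp_seq; apply: (wp_parse_num sp a1) => t1 s1 f1 c1 r1 p1.
apply: wp_seq; apply: wp_store => /=.
pose J i t' s' := [/\ i <= size l /\ s' jj 0 = i, s' tot 0 = size l, s' inp = s inp,
   at_ (s' x) 0 (take i l) & s' pos 0 = p + e0 + E i /\ t' <= t + 190 * e0 + 200 * E i].
apply: (@wp_for (size l) J _ _ _ _ _ _ (t + 200 * (e0 + E (size l)))).
- rewrite /J; fin.
  + by rewrite (f1 0).
  + by rewrite take0.
- move=> i t' s' [[i1 i2] i3 i4 i5 [i6 i7]]; fin.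
  have : E i <= E (size l) by rewrite /E take_size -{2}(cat_take_drop i l) map_cat flatten_cat size_cat; lia.
  by lia.
{ move=> i t' s' il [[i1 i2] i3 i4 i5 [i6 i7]].
  have a3 : at_ (s' inp) (p + e0 + E i) (map nat_of_bool (enc_nat (nth 0 l i))).
    by apply: step => //; rewrite i4.
  apply: wp_seq; apply: (wp_parse_num i6 a3) => t2 s2 f2 /= c2 r2 p2; apply: wp_store => /=.
  have np : 0 < size (enc_nat (nth 0 l i)) by rewrite size_enc_nat.
  rewrite /J; move: hx i5; rewrite !inE => /orP[] /eqP -> i5.
  all: fin; rewrite ?(f2 18) ?(f2 17) ?(f2 0) ?(f2 2) ?(f2 3) ?i2 ?r2 ?ES //; try lia.
  all: rewrite (take_nth 0) //; have := @at_setf _ _ _ (nth 0 l i) i5.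
  all: by rewrite add0n size_takel. }
move=> t' s' [[i1 i2] i3 i4 i5 [i6 i7]]; rewrite /R; fin.
by move: i5; rewrite take_size.
Qed.

(** * Offsets, widths and powers of two derived from the input *)

Notation lenw := 6 (only parsing).
Notation len := 7 (only parsing).
Notation bBeta := 8 (only parsing).
Notation bZeta := 9 (only parsing).
Notation bTrans := 10 (only parsing).
Notation mm := 11 (only parsing).
Notation wid := 12 (only parsing).
Notation pow := 13 (only parsing).

Definition betas (A : automaton) := [seq beta x | x <- enum 'I_(nX A)].
Definition widths (A : automaton) := [seq width (beta x) | x <- enum 'I_(nX A)].
Definition nbits (A : automaton) := \sum_(x < nX A) width (beta x).

Lemma size_betas A : size (betas A) = nX A.
Proof. by rewrite size_map size_enum_ord. Qed.

Lemma size_widths A : size (widths A) = nX A.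
Proof. by rewrite size_map size_enum_ord. Qed.

Lemma widthsE A : widths A = map width (betas A).
Proof. by rewrite -map_comp. Qed.

Lemma sumn_widths A : sumn (widths A) = nbits A.
Proof. by rewrite sumnE big_map big_enum. Qed.

Lemma nth_betas A (x : 'I_(nX A)) : nth 0 (betas A) x = beta x.
Proof. by rewrite (nth_map x) ?size_enum_ord // nth_ord_enum. Qed.

Lemma nth_widths A (x : 'I_(nX A)) : nth 0 (widths A) x = width (beta x).
Proof. by rewrite (nth_map x) ?size_enum_ord // nth_ord_enum. Qed.

Lemma at_flatten_const f p k L i :
  all (fun l => size l == k) L -> at_ f p (flatten L) -> i < size L ->
  at_ f (p + i * k) (nth [::] L i).
Proof.
elim: L i p => // l L IH [|i] p /= /andP[/eqP lk Lk] /at_cat[h1 h2] il.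
  by rewrite addn0.
by have := IH i _ Lk h2 il; rewrite lk -addnA mulSn.
Qed.

Lemma at_nth f p l i v : at_ f p l -> i < size l -> nth 0 l i = v -> f (p + i) = v.
Proof. by move=> h il <-; apply: h. Qed.

(** [bBeta], [bZeta] and [bTrans] are the offsets in [num] of the sections of the code, which follow
    6 header fields. [tot] is the length of the query, which starts with the letter and [n], hence
    the 2 subtracted. Adding [nQ] once per stopwatch replaces the product in [bTrans], and a width
    is found by repeated doubling. *)
Definition setup : prog :=
  lenw ::= Minus $tot (Const 2) ;;
  len ::= Add $lenw (wd @ (Const 1)) ;;
  bBeta ::= Add (Const 6) (num @ (Const 0)) ;;
  bZeta ::= Add $bBeta (num @ (Const 2)) ;;
  bTrans ::= $bZeta ;;
  mm ::= Const 0 ;;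
  For jj (num @ (Const 2))
    (bTrans ::= Add $bTrans (num @ (Const 0)) ;;
     tot ::= Const 1 ;; cnt ::= Const 0 ;;
     While (Minus (Add (num @ (Add $bBeta $jj)) (Const 1)) $tot)
       (tot ::= Add $tot $tot ;; cnt ::= Add $cnt (Const 1)) ;;
     Store wid $jj $cnt ;;
     mm ::= Add $mm $cnt) ;;
  Store pow (Const 0) (Const 1) ;;
  For jj $mm (Store pow (Add $jj (Const 1)) (Add (pow @ $jj) (pow @ $jj))).

(** What the search never changes. These arrays have numbers from 2 to 13 and all later writes go
    elsewhere, so preservation is a range check. *)
Record static (A : automaton) (w : seq 'I_(nS A)) (a : 'I_(nS A)) (n : nat)
    (s : memory) : Prop := Static {
  st_num : at_ (s num) 0 (automaton_nats A);
  st_wd : at_ (s wd) 0 (nat_of_ord a :: n :: map val w);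
  st_lenw : s lenw 0 = size w;
  st_len : s len 0 = size w + n;
  st_bBeta : s bBeta 0 = 6 + nQ A;
  st_bZeta : s bZeta 0 = 6 + nQ A + nX A;
  st_bTrans : s bTrans 0 = 6 + nQ A + nX A + nX A * nQ A;
  st_mm : s mm 0 = nbits A;
  st_wid : at_ (s wid) 0 (widths A);
  st_pow : forall i, i <= nbits A -> s pow i = 2 ^ i
}.

(** * Locating the fields of the automaton in its code *)

Section Lookup.

Variables (A : automaton) (f : nat -> nat).
Hypothesis h : at_ f 0 (automaton_nats A).

Lemma num_head :
  [/\ f 0 = nQ A, f 2 = nX A, f 3 = nD A, f 4 = start A & f 5 = accept A].
Proof.
by split; [exact: (h (i := 0)) | exact: (h (i := 2)) | exact: (h (i := 3))
  | exact: (h (i := 4)) | exact: (h (i := 5))].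
Qed.

Lemma num_lambda (q : 'I_(nQ A)) : f (6 + q) = lambda q.
Proof.
move: h => /at_cat[_ /at_cat[+ _]] => /at_nth; apply.
  by rewrite size_map size_enum_ord.
by rewrite (nth_map q) ?size_enum_ord // nth_ord_enum.
Qed.

Lemma num_beta (x : nat) : x < nX A -> f (6 + nQ A + x) = nth 0 (betas A) x.
Proof.
move=> xX; move: h => /at_cat[_ /at_cat[_ /at_cat[+ _]]].
rewrite size_map size_enum_ord => /at_nth; apply=> //.
by rewrite size_map size_enum_ord.
Qed.

Lemma num_zeta (x : 'I_(nX A)) (q : 'I_(nQ A)) :
  f (6 + nQ A + nX A + x * nQ A + q) = zeta x q.
Proof.
move: h => /at_cat[_ /at_cat[_ /at_cat[_ /at_cat[+ _]]]].
rewrite 2!size_map !size_enum_ord.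
move=> /(at_flatten_const (k := nQ A)) => /(_ x).
rewrite size_map size_enum_ord => hh.
have /hh : all (fun l => size l == nQ A)
   [seq [seq nat_of_bool (zeta x0 y) | y <- enum 'I_(nQ A)] | x0 <- enum 'I_(nX A)].
  by apply/allP => _ /mapP[y _ ->]; rewrite size_map size_enum_ord.
move=> /(_ (ltn_ord x)); rewrite (nth_map x) ?size_enum_ord // nth_ord_enum.
move=> /at_nth; apply; first by rewrite size_map size_enum_ord.
by rewrite (nth_map q) ?size_enum_ord // nth_ord_enum.
Qed.

Lemma num_trans :
  at_ f (6 + nQ A + nX A + nX A * nQ A)
    (flatten [seq transition_nats (Delta d) | d <- enum 'I_(nD A)]).
Proof.
move: h => /at_cat[_ /at_cat[_ /at_cat[_ /at_cat[_ +]]]].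
by rewrite size_allpairs 2!size_map !size_enum_ord.
Qed.

End Lookup.

Lemma nats_size A : size (automaton_nats A) =
  6 + nQ A + nX A + nX A * nQ A +
  size (flatten [seq transition_nats (Delta d) | d <- enum 'I_(nD A)]).
Proof. by rewrite !size_cat size_allpairs 2!size_map !size_enum_ord /=; lia. Qed.

Lemma size_flatten_enc_width l :
  size (flatten [seq enc_nat m | m <- l]) = size l + 2 * sumn (map width l).
Proof. by elim: l => //= m l IH; rewrite size_cat size_enc_nat IH; lia. Qed.

Lemma size_enc_nats l :
  size (enc_nats l) = 2 * width (size l) + (size l).+1 + 2 * sumn (map width l).
Proof. by rewrite /enc_nats /= size_cat size_enc_nat size_flatten_enc_width; lia. Qed.

(** Each number of the code takes one bit plus twice its width. Of the widths only those of the
    bounds and of [nS] are kept: the former pay for the work on assignment bits, the latter for the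
    letters of the query, which are smaller than [nS]. *)
Lemma automaton_size_ge A :
  size (automaton_nats A) + 2 * (nbits A + width (nS A)) <= automaton_size A.
Proof.
rewrite /automaton_size /automaton_code size_enc_nats.
rewrite {3}/automaton_nats !map_cat !sumn_cat /=.
by rewrite -/(betas A) -widthsE sumn_widths; lia.
Qed.

Lemma wp_setup A w a n (Q : nat -> memory -> Prop) t s :
  at_ (s num) 0 (automaton_nats A) ->
  at_ (s wd) 0 (nat_of_ord a :: n :: map val w) ->
  s tot 0 = (size w).+2 ->
  (forall t' s', framed setup s s' -> t' <= t + 300 * automaton_size A ->
     @static A w a n s' -> Q t' s') ->
  wp setup Q t s.
Proof.
move=> hn hw ht h.
pose R t' s' := t' <= t + 300 * automaton_size A /\ @static A w a n s'.
suff wR : wp setup R t s by apply: wp_mono wR _ => t' s' fr []; apply: h.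
have [n0 n2 n3 n4 n5] := num_head hn.
have w1 : s wd 1 = n by exact: (hw 1).
have asz := automaton_size_ge A; have nsz := nats_size A.
do 12 st; mem; rewrite /= ?setf_eq /= ?n0 ?n2 w1 ht.
apply: wp_seq.
pose U i := sumn (take i (widths A)).
pose J i t' s' := [/\ i <= nX A /\ s' jj 0 = i, s' mm 0 = U i /\ t' <= t + 100 + 100 * (i + U i),
   at_ (s' wid) 0 (take i (widths A)), s' bTrans 0 = 6 + nQ A + nX A + i * nQ A &
   [/\ s' num = s num, s' wd = s wd, s' lenw 0 = size w /\ s' len 0 = size w + n,
   s' bBeta 0 = 6 + nQ A & s' bZeta 0 = 6 + nQ A + nX A]].
have Ule i : U i <= nbits A.
  by rewrite -sumn_widths -{1}(cat_take_drop i (widths A)) sumn_cat; apply: leq_addr.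
apply: (@wp_for (nX A) J _ _ _ _ _ _ (t + 100 + 100 * (nX A + nbits A))).
- rewrite /J; fin; rewrite ?n0 ?n2; fin.
  by rewrite /U take0.
  by rewrite take0.
- move=> i t' s' [[i1 i2] [i3 i4] _ _ [i5 _ _ _ _]]; fin; rewrite ?i5 ?n2 //.
  by have := Ule i; lia.
{ move=> i t' s' iX [[i1 i2] [i3 i4] i5 i6 [i7 i8 [i9 i10] i11 i12]].
  do 7 st; mem; rewrite /= ?setf_eq /= i6 i7 n0.
  set k := nth 0 (widths A) i; set b := nth 0 (betas A) i.
  have bk : k = width b by rewrite /k widthsE (nth_map 0) // size_betas.
  pose F := update (update (update s' 10 0 (6 + nQ A + nX A + i * nQ A + nQ A)) 17 0 1) 14 0 0.
  pose I t'' s'' := exists j, [/\ j <= k, s'' tot 0 = 2 ^ j, s'' cnt 0 = j,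
     t'' <= t' + 30 + 30 * j & forall y, y \notin [:: tot; cnt] -> s'' y = F y].
  apply: (@wp_while (t' + 30 + 30 * k) I).
  + by exists 0; fin; move: F.
  + by move=> t'' s'' [j [? _ _ ? _]]; lia.
  + move=> t'' s'' [j [j1 j2 j3 j4 j5]] /=.
    rewrite (j5 2) // (j5 8) // (j5 18) // /F; memr; rewrite i7 i11 i2 num_beta // j2 => nz.
    have {}j1 : j < k.
      case: (ltnP j k) => // kj; have := ltn_width b; rewrite -bk.
      by have : 2 ^ k <= 2 ^ j; [rewrite leq_exp2l | lia].
    do 3 st; exists j.+1; fin; rewrite ?j2 ?j3 ?expnS; try lia.
    move=> y; rewrite !inE => /norP[/negbTE y1 /negbTE y2].
    by rewrite update_other // update_other // j5 // !inE y1 y2.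
  move=> t'' s'' [j [j1 j2 j3 j4 j5]] /=.
  rewrite (j5 2) // (j5 8) // (j5 18) // /F; memr; rewrite i7 i11 i2 num_beta // j2 => z.
  (* On exit [b.+1 <= 2 ^ j], and [up_log] is the least such exponent. *)
  have {j1} j1 : j = k.
    by apply/eqP; rewrite eqn_leq j1 bk up_log_min //; rewrite /b; lia.
  have Ui : U i.+1 = U i + k by rewrite /U (take_nth 0) ?size_widths // sumn_rcons.
  do 3 st; rewrite /J; fin.
  all: rewrite ?(j5 18) ?(j5 11) ?(j5 12) ?(j5 10) ?(j5 2) ?(j5 3) ?(j5 6) ?(j5 7) ?(j5 8) ?(j5 9) // /F; memr.
  all: rewrite ?i2 ?i3 ?j3 ?Ui ?j1 ?mulSn //; try lia.
  have := @at_setf _ _ _ k i5; rewrite add0n size_takel ?size_widths //.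
  by rewrite (take_nth 0) ?size_widths. }
move=> t1 s1 [[i1 i2] [i3 i4] i5 i6 [i7 i8 [i9 i10] i11 i12]] /=.
do 2 st.
have UX : U (nX A) = nbits A by rewrite /U take_oversize ?size_widths ?sumn_widths.
rewrite UX in i3 i4.
pose J2 i t' s' := [/\ s' jj 0 = i /\ i <= nbits A, forall k, k <= i -> s' pow k = 2 ^ k,
  t' <= t1 + 30 + 40 * i & forall y, y \notin [:: pow; jj] -> s' y = s1 y].
apply: (@wp_for (nbits A) J2 _ _ _ _ _ _ (t1 + 30 + 40 * nbits A)).
- rewrite /J2; fin; first by case.
  move=> y; rewrite !inE => /norP[/negbTE y1 /negbTE y2].
  by rewrite !update_other.
- by move=> i t' s' [[k1 k2] _ k3 k4]; fin; rewrite (k4 11).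
- move=> i t' s' ib [[k1 k2] k3 k4 k5]; st; rewrite /J2; fin.
    move=> k; rewrite /setf k1 addn1; case: eqP => [-> _|ki kk].
      by rewrite k3 // expnS; lia.
    by apply: k3; lia.
  move=> y; rewrite !inE => /norP[/negbTE y1 /negbTE y2].
  by rewrite !update_other // k5 // !inE y1 y2.
move=> t' s' [[k1 k2] k3 k4 k5]; split; first by rewrite /=; lia.
split=> //; rewrite ?(k5 2) ?(k5 3) ?(k5 6) ?(k5 7) ?(k5 8) ?(k5 9) ?(k5 10) ?(k5 11) ?(k5 12) //.
- by rewrite i7.
- by rewrite i8.
by rewrite take_oversize ?size_widths in i5.
Qed.

(** * Circuits *)

Notation bits := 21 (only parsing).
Notation ptr := 23 (only parsing).
Notation gi := 30 (only parsing).
Notation vals := 31 (only parsing).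
Notation ox := 32 (only parsing).
Notation oy := 33 (only parsing).
Notation ng := 34 (only parsing).
Notation obits := 35 (only parsing).

(** The nested tests dispatch on the tags 0 to 4 of [gate_nats]. On bits, with truncated
    subtraction, NOT is 1 - x, AND is x + y - 1 and OR is 1 - ((1 - x) - y). *)
Definition gate_step : prog :=
  ox ::= num @ (Add $ptr (Const 1)) ;;
  oy ::= num @ (Add $ptr (Const 2)) ;;
  If (num @ $ptr)
    (If (Minus (num @ $ptr) (Const 1))
      (If (Minus (num @ $ptr) (Const 2))
        (If (Minus (num @ $ptr) (Const 3))
          (Store vals $gi (Minus (Const 1) (Minus (Minus (Const 1) (vals @ $ox)) (vals @ $oy))) ;;
           ptr ::= Add $ptr (Const 3))
          (Store vals $gi (Minus (Add (vals @ $ox) (vals @ $oy)) (Const 1)) ;;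
           ptr ::= Add $ptr (Const 3)))
        (Store vals $gi (Minus (Const 1) (vals @ $ox)) ;;
         ptr ::= Add $ptr (Const 2)))
      (Store vals $gi (bits @ $ox) ;;
       ptr ::= Add $ptr (Const 2)))
    (Store vals $gi $ox ;;
     ptr ::= Add $ptr (Const 2)).

(** The code of a circuit states its number of gates but not its number of outputs, which is
    therefore supplied by [e]: 1 for a guard, the number of assignment bits for an action. *)
Definition circ (e : expr) : prog :=
  ng ::= num @ $ptr ;;
  ptr ::= Add $ptr (Const 1) ;;
  For gi $ng gate_step ;;
  For gi e
    (Store obits $gi (vals @ (num @ $ptr)) ;; ptr ::= Add $ptr (Const 1)).

Lemma gate_vals_rcons inp gs g :
  gate_vals inp (rcons gs g) = rcons (gate_vals inp gs) (gate_val inp (gate_vals inp gs) g).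
Proof. by rewrite /gate_vals foldl_rcons. Qed.

Lemma size_gate_vals inp gs : size (gate_vals inp gs) = size gs.
Proof. by elim/last_ind: gs => // gs g IH; rewrite gate_vals_rcons !size_rcons IH. Qed.

Lemma gate_ok_nth m k (C : circuit m k) i :
  i < size (gates C) -> gate_ok m i (nth (GConst false) (gates C) i).
Proof.
move=> ic; have /(all_nthP (0, GConst false)) := gates_ok C => /(_ i).
rewrite size_zip size_iota minnn => /(_ ic).
by rewrite nth_zip ?size_iota //= nth_iota.
Qed.

Lemma at_bool f l j : at_ f 0 (map nat_of_bool l) -> j < size l -> f j = nth false l j.
Proof. by move=> h jl; rewrite -(add0n j) h ?size_map // (nth_map false). Qed.

Lemma wp_gate_step m inps vs i p g (Q : nat -> memory -> Prop) t s :
  size inps = m -> at_ (s bits) 0 (map nat_of_bool inps) ->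
  size vs = i -> at_ (s vals) 0 (map nat_of_bool vs) ->
  s gi 0 = i -> s ptr 0 = p -> at_ (s num) p (gate_nats g) -> gate_ok m i g ->
  (forall t' s', framed gate_step s s' -> t' <= t + 60 ->
     at_ (s' vals) 0 (map nat_of_bool (rcons vs (gate_val inps vs g))) ->
     s' ptr 0 = p + size (gate_nats g) -> Q t' s') ->
  wp gate_step Q t s.
Proof.
move=> im hb vi hv gs ps hn ok h.
pose R t' s' := [/\ t' <= t + 60, at_ (s' vals) 0 (map nat_of_bool (rcons vs (gate_val inps vs g)))
  & s' ptr 0 = p + size (gate_nats g)].
suff wR : wp gate_step R t s by apply: wp_mono wR _ => t' s' fr []; apply: h.
have fin b v : v = nat_of_bool b -> at_ (setf (s vals) i v) 0 (map nat_of_bool (rcons vs b)).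
  move=> ->; rewrite map_rcons; have := @at_setf _ _ _ (nat_of_bool b) hv.
  by rewrite size_map vi.
have [n0 n1] : s num p = nth 0 (gate_nats g) 0 /\ s num p.+1 = nth 0 (gate_nats g) 1.
  by have := hn 0; have := hn 1; rewrite addn0 addn1; case: (g) => /=; auto.
have n2 : 2 < size (gate_nats g) -> s num p.+2 = nth 0 (gate_nats g) 2.
  by have := hn 2; rewrite addn2.
do 4 st; mem; rewrite /= ps.
(* One case per kind of gate. The final [case: nth] checks the truth tables of the arithmetic
   expressions. *)
by case: g ok n0 n1 n2 {hn h} @R fin => [b|j|j|j k|j k] /= ok n0 n1 n2 fin;
  repeat first [apply: wp_if => /=; mem; rewrite /= ps n0 //= => _ | st];
  split; memr; rewrite ?ps //; try lia; rewrite gs; apply: fin; rewrite ?addn1 ?addn2 n1 ?n2 //;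
  rewrite ?(at_bool hb) ?(at_bool hv) ?im ?vi //; try (by case/andP: ok);
  repeat case: nth.
Qed.

(** The condition on [e] fits both [Const 1] and [$mm]: its value must survive the writes of the
    loops, and these leave [mm] alone. *)
Lemma wp_circ m k (C : circuit m k) inps e p (Q : nat -> memory -> Prop) t s :
  size inps = m -> at_ (s bits) 0 (map nat_of_bool inps) ->
  s ptr 0 = p -> at_ (s num) p (circuit_nats C) ->
  (forall s', s' mm = s mm -> expr_val s' e = k) -> expr_cost e <= 2 ->
  (forall t' s', framed (circ e) s s' -> t' <= t + 100 * size (circuit_nats C) ->
     at_ (s' obits) 0 (map nat_of_bool (circuit_eval C inps)) ->
     s' ptr 0 = p + size (circuit_nats C) -> Q t' s') ->
  wp (circ e) Q t s.
Proof.
move=> im hb ps hn ek ec h.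
pose R t' s' := [/\ t' <= t + 100 * size (circuit_nats C),
  at_ (s' obits) 0 (map nat_of_bool (circuit_eval C inps))
  & s' ptr 0 = p + size (circuit_nats C)].
suff wR : wp (circ e) R t s by apply: wp_mono wR _ => t' s' fr []; apply: h.
rewrite /R {h R}; move: hn; rewrite /circuit_nats at_cons at_cat => -[n0 [n1 n2]].
set gs := gates C; set n := size gs in n0 *.
pose E i := size (flatten [seq gate_nats g | g <- take i gs]).
have EE : size (flatten [seq gate_nats g | g <- gs]) = E n by rewrite /E take_size.
rewrite /= size_cat EE size_tuple; rewrite EE in n2.
have g2 g : 1 < size (gate_nats g) by case: g.
have ES i : i < n -> E i.+1 = E i + size (gate_nats (nth (GConst false) gs i)).
  by move=> il; rewrite /E (take_nth (GConst false)) // map_rcons flatten_rcons size_cat.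
have Ele i : i <= n -> E i <= E n.
  by move=> _; rewrite -EE -{1}(cat_take_drop i gs) map_cat flatten_cat size_cat leq_addr.
have E2 : n <= E n.
  rewrite /E take_size /n; elim: (gs) => //= g l IH; rewrite size_cat.
  by have := g2 g; lia.
have gp i : i < n -> at_ (s num) (p.+1 + E i) (gate_nats (nth (GConst false) gs i)).
  move=> il; move: n1; rewrite -/gs -{1}(cat_take_drop i gs) map_cat flatten_cat at_cat.
  by case=> _; rewrite (drop_nth (GConst false)) //= at_cat => -[].
do 4 st; mem; rewrite /= ps n0.
pose J i t' s' := [/\ i <= n /\ s' gi 0 = i, s' ng 0 = n /\ s' ptr 0 = p.+1 + E i,
  t' <= t + 30 + 80 * E i,
  at_ (s' vals) 0 (map nat_of_bool (gate_vals inps (take i gs))) &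
  [/\ s' num = s num, s' bits = s bits & s' mm = s mm]].
st; apply: (@wp_for n J _ _ _ _ _ _ (t + 30 + 80 * E n)).
- rewrite /J; fin; rewrite ?take0; fin.
  + by rewrite /E take0 /=; lia.
- move=> i t' s' [[i1 i2] [i3 i4] i5 i6 [i7 i8 i9]]; fin.
  by have := Ele i i1; lia.
- move=> i t' s' iN [[i1 i2] [i3 i4] i5 i6 [i7 i8 i9]].
  apply: (@wp_gate_step m inps (gate_vals inps (take i gs)) i _ (nth (GConst false) gs i)) => //.
  + by rewrite i8.
  + by rewrite size_gate_vals size_takel.
  + by rewrite i7 i4; apply: gp.
  + exact: gate_ok_nth.
  move=> t'' s'' fr /= tt at' pt'; have := g2 (nth (GConst false) gs i) => gg.
  rewrite /J; fin; rewrite ?(fr 30) ?(fr 34) ?(fr 2) ?(fr 21) ?(fr 11) ?i2 ?pt' ?i4 ?ES //; try lia.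
  by rewrite (take_nth (GConst false)) // gate_vals_rcons.
move=> t1 s1 [[i1 i2] [i3 i4] i5 i6 [i7 i8 i9]] /=.
rewrite take_size in i6.
pose cv j := nat_of_bool (nth false (gate_vals inps gs) j).
pose J2 i t' s' := [/\ i <= k /\ s' gi 0 = i, s' ptr 0 = p.+1 + E n + i,
  t' <= t + 50 + 80 * E n + 30 * i,
  at_ (s' obits) 0 (map cv (take i (outs C))) &
  [/\ s' num = s num, s' vals = s1 vals & s' mm = s mm]].
apply: (@wp_for k J2 _ _ _ _ _ _ (t + 50 + 80 * E n + 30 * k)).
- by rewrite /J2; fin; rewrite ?take0 //; fin.
- move=> i t' s' [[j1 j2] j3 j4 j5 [j6 j7 j8]]; fin.
  exact: ek.
- move=> i t' s' ik [[j1 j2] j3 j4 j5 [j6 j7 j8]].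
  have o1 : s num (p.+1 + E n + i) = nth 0 (outs C) i by apply: n2; rewrite size_tuple.
  have o2 : nth 0 (outs C) i < n.
    by have /(all_nthP 0) := outs_ok C; apply; rewrite size_tuple.
  do 3 st; rewrite /J2; fin; rewrite ?j2 ?j3 ?j6 ?j7 ?o1 //; try lia.
  rewrite (take_nth 0) ?size_tuple // map_rcons.
  have := @at_setf _ _ _ (cv (nth 0 (outs C) i)) j5.
  by rewrite add0n size_map size_takel ?size_tuple // /cv -(at_bool i6) ?size_gate_vals.
move=> t' s' [[j1 j2] j3 j4 j5 [j6 j7 j8]]; fin.
by rewrite take_oversize ?size_tuple // in j5; rewrite /circuit_eval -map_comp.
Qed.

(** * Coding assignments by numbers *)

Notation ui := 24 (only parsing).
Notation cc := 25 (only parsing).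
Notation flag := 40 (only parsing).
Notation qq := 41 (only parsing).
Notation gg := 42 (only parsing).
Notation code := 43 (only parsing).
Notation bp := 44 (only parsing).
Notation zp := 45 (only parsing).
Notation xx := 46 (only parsing).
Notation vv := 47 (only parsing).
Notation bi := 48 (only parsing).
Notation be := 49 (only parsing).

(** In place of divisions, the digits are found from the top by comparing the rest [cc] with a
    tabulated power of two and subtracting it if possible. *)
Definition unpack : prog :=
  For ui $mm
    (If (Minus (Add $cc (Const 1)) (pow @ (Minus $mm (Add $ui (Const 1)))))
       (Store bits $ui (Const 1) ;; cc ::= Minus $cc (pow @ (Minus $mm (Add $ui (Const 1)))))
       (Store bits $ui (Const 0))).

(** Each block is read by Horner's rule and then capped, v - (v - beta) being the minimum. [code]
    and [gg] are doubled once per bit, which makes room for the capped value; as [gg] starts with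
    the higher digits of a configuration, it ends as its table index. If [flag] is set, zeta is
    added before capping, so the same routine performs a unit time step; [zp] runs down the column
    of [qq] in the table of zeta. *)
Definition pack : prog :=
  code ::= Const 0 ;; bp ::= Const 0 ;; zp ::= Add $bZeta $qq ;;
  For xx (num @ (Const 2))
    (vv ::= Const 0 ;;
     For bi (wid @ $xx)
       (vv ::= Add (Add $vv $vv) (obits @ $bp) ;;
        bp ::= Add $bp (Const 1) ;;
        code ::= Add $code $code ;;
        gg ::= Add $gg $gg) ;;
     If $flag (vv ::= Add $vv (num @ $zp)) Skip ;;
     zp ::= Add $zp (num @ (Const 0)) ;;
     be ::= num @ (Add $bBeta $xx) ;;
     vv ::= Minus $vv (Minus $vv $be) ;;
     code ::= Add $code $vv ;;
     gg ::= Add $gg $vv).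

Definition code_of (A : automaton) (xi : assignment A) : nat :=
  bin_val (assignment_bits xi).

Lemma bin_val_cons b s : bin_val (b :: s) = b * 2 ^ size s + bin_val s.
Proof. by rewrite -cat1s bin_val_cat. Qed.

Lemma shape_blocks (A : automaton) (v : 'I_(nX A) -> nat) :
  shape [seq bin (width (beta x)) (v x) | x <- enum 'I_(nX A)] = widths A.
Proof. by rewrite /shape -map_comp; apply: eq_map => x /=; rewrite size_bin. Qed.

Lemma size_assignment_bits (A : automaton) (xi : assignment A) :
  size (assignment_bits xi) = nbits A.
Proof. by rewrite size_flatten shape_blocks sumn_widths. Qed.

Lemma code_lt (A : automaton) (xi : assignment A) : code_of xi < 2 ^ nbits A.
Proof. by rewrite -(size_assignment_bits xi) bin_val_lt. Qed.

(** The lengths of the blocks depend only on the bounds, so the concatenation can be cut back into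
    blocks, and each value fits into its block. *)
Lemma code_inj (A : automaton) : injective (@code_of A).
Proof.
move=> xi xi' /bin_val_inj; rewrite !size_assignment_bits => /(_ erefl) e.
apply/ffunP => x; apply: val_inj => /=.
have := congr1 (fun s => bin_val (nth [::] (reshape (widths A) s) x)) e.
rewrite /assignment_bits -{1}(shape_blocks (fun x => val (xi x))) -(shape_blocks (fun x => val (xi' x))).
have E (y : assignment A) : nth [::] [seq bin (width (beta z)) (val (y z)) | z <- enum 'I_(nX A)] x = bin (width (beta x)) (y x).
  by rewrite (nth_map x) ?size_enum_ord // nth_ord_enum.
rewrite !flattenK !E.
have lt (y : assignment A) : y x < 2 ^ width (beta x).
  by apply: leq_trans (ltn_ord _) _; apply: ltn_width.
by rewrite !bin_val_bin.
Qed.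

Lemma capE (A : automaton) (v : 'I_(nX A) -> nat) x : cap v x = minn (v x) (beta x) :> nat.
Proof. by rewrite ffunE inordK // ltnS geq_minr. Qed.

Lemma assignment_bits_cap (A : automaton) (v : 'I_(nX A) -> nat) :
  assignment_bits (cap v) =
  flatten [seq bin (width (beta x)) (minn (v x) (beta x)) | x <- enum 'I_(nX A)].
Proof. by congr flatten; apply: eq_map => x; rewrite capE. Qed.

Lemma wp_unpack (A : automaton) w a n l (Q : nat -> memory -> Prop) t s :
  @static A w a n s -> size l = nbits A -> s cc 0 = bin_val l ->
  (forall t' s', framed unpack s s' -> t' <= t + 20 + 60 * nbits A ->
     at_ (s' bits) 0 (map nat_of_bool l) -> Q t' s') ->
  wp unpack Q t s.
Proof.
move=> st0 sl sc h; have sm := st_mm st0; have sp := st_pow st0.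
pose R t' s' := t' <= t + 20 + 60 * nbits A /\ at_ (s' bits) 0 (map nat_of_bool l).
suff wR : wp unpack R t s by apply: wp_mono wR _ => t' s' fr []; apply: h.
pose J i t' s' := [/\ i <= nbits A /\ s' ui 0 = i, s' mm = s mm /\ s' pow = s pow,
  t' <= t + 10 + 60 * i, s' cc 0 = bin_val (drop i l)
  & at_ (s' bits) 0 (map nat_of_bool (take i l))].
apply: (@wp_for (nbits A) J _ _ _ _ _ _ (t + 10 + 60 * nbits A)).
- by rewrite /J; fin; rewrite ?take0 ?drop0.
- by move=> i t' s' [[i1 i2] [i3 i4] i5 _ _]; fin; rewrite i3.
- move=> i t' s' im [[i1 i2] [i3 i4] i5 i6 i7].
  have e : s' pow (s' mm 0 - (s' ui 0 + 1)) = 2 ^ size (drop i.+1 l).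
    by rewrite i4 i3 i2 size_drop sl addn1 sm sp //; lia.
  rewrite (drop_nth false) ?sl // bin_val_cons in i6.
  have lt := bin_val_lt (drop i.+1 l).
  have tk v : v = nat_of_bool (nth false l i) ->
      at_ (setf (s' bits) i v) 0 (map nat_of_bool (take i.+1 l)).
    move=> ->; rewrite (take_nth false) ?sl // map_rcons.
    have := @at_setf _ _ _ (nat_of_bool (nth false l i)) i7.
    by rewrite size_map size_takel ?sl.
  apply: wp_if => /=; rewrite e i6; case: (nth false l i) tk i6 => /= tk i6 E; try lia.
  + by do 3 st; rewrite /J; fin; rewrite ?e ?i2 ?i6 ?i3 ?i4; try lia; exact: tk.
  by do 1 st; rewrite /J; fin; rewrite ?i2 ?i6 ?i3; try lia; exact: tk.
move=> t' s' [[i1 i2] [i3 i4] i5 _ i7]; split; first by rewrite /=; lia.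
by rewrite take_oversize ?sl in i7.
Qed.

Lemma wp_pack (A : automaton) w a n ob (q : 'I_(nQ A)) (fl : bool) g0
    (Q : nat -> memory -> Prop) t s :
  @static A w a n s -> size ob = nbits A ->
  at_ (s obits) 0 (map nat_of_bool ob) ->
  s flag 0 = fl -> s qq 0 = q -> s gg 0 = g0 ->
  (forall t' s', framed pack s s' -> t' <= t + 50 + 200 * (nX A + nbits A) ->
     let k := code_of (cap (fun x => block_val ob x + fl * zeta x q)) in
     s' code 0 = k -> s' gg 0 = g0 * 2 ^ nbits A + k -> Q t' s') ->
  wp pack Q t s.
Proof.
move=> st0 so hb hf hq hg h.
set v := fun x => block_val ob x + fl * zeta x q.
pose K := code_of (cap v).
pose R t' s' := [/\ t' <= t + 50 + 200 * (nX A + nbits A), s' code 0 = K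
  & s' gg 0 = g0 * 2 ^ nbits A + K].
suff wR : wp pack R t s by apply: wp_mono wR _ => t' s' fr [] *; apply: h.
have [n0 n2 _ _ _] := num_head (st_num st0).
have hB := st_bBeta st0; have hZ := st_bZeta st0.
pose bs := [seq bin (width (beta x)) (minn (v x) (beta x)) | x <- enum 'I_(nX A)].
pose U i := sumn (take i (widths A)).
have szb : size bs = nX A by rewrite size_map size_enum_ord.
have szf i : size (flatten (take i bs)) = U i.
  by rewrite size_flatten /shape map_take -/(shape bs) /bs shape_blocks.
pose cd i := bin_val (flatten (take i bs)).
have cdK : cd (nX A) = K.
  by rewrite /cd take_oversize ?szb // /K /code_of assignment_bits_cap.
have Ule i : U i <= nbits A.
  by rewrite -sumn_widths -{1}(cat_take_drop i (widths A)) sumn_cat leq_addr.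
have US (x : 'I_(nX A)) : U x.+1 = U x + width (beta x).
  by rewrite /U (take_nth 0) ?size_widths // sumn_rcons nth_widths.
have UX : U (nX A) = nbits A by rewrite /U take_oversize ?size_widths ?sumn_widths.
(* The capped value fits into its block, so appending the block shifts the code by the width and
   adds the value. *)
have cdS (x : 'I_(nX A)) : cd x.+1 = cd x * 2 ^ width (beta x) + minn (v x) (beta x).
  rewrite /cd (take_nth [::]) ?szb // flatten_rcons bin_val_cat (nth_map x) ?size_enum_ord //.
  rewrite nth_ord_enum size_bin bin_val_bin //.
  by apply: leq_ltn_trans (geq_minr _ _) (ltn_width _).
do 6 st; mem; rewrite /= hZ hq.
pose J i t' s' := [/\ i <= nX A /\ s' xx 0 = i, s' bp 0 = U i /\ s' zp 0 = 6 + nQ A + nX A + i * nQ A + q,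
  t' <= t + 40 + 150 * (i + U i), s' code 0 = cd i /\ s' gg 0 = g0 * 2 ^ U i + cd i &
  [/\ s' num = s num, s' wid = s wid, s' obits = s obits, s' flag 0 = fl & s' bBeta = s bBeta]].
apply: (@wp_for (nX A) J _ _ _ _ _ _ (t + 40 + 150 * (nX A + nbits A))).
- rewrite /J; fin; rewrite /U /cd take0 //=.
  by rewrite hg take0 /bin_val /=; lia.
- move=> i t' s' [[i1 i2] [i3 i4] i5 [i6 i7] [i8 i9 i10 i11 i12]]; fin; rewrite ?i8 //.
  by have := Ule i; lia.
{ move=> i t' s' iX [[i1 i2] [i3 i4] i5 [i6 i7] [i8 i9 i10 i11 i12]].
  pose x := Ordinal iX; have xi : i = x by [].
  set k := width (beta x).
  have wk : s wid i = k by have := st_wid st0 (i := i); rewrite size_widths xi nth_widths; apply.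
  pose bl := take k (drop (U i) ob).
  have blE : block_val ob x = bin_val bl.
    by rewrite /block_val nth_reshape -/(widths A) nth_widths.
  have Uk : U i + k <= nbits A by have := Ule i.+1; rewrite xi US.
  have szbl : size bl = k by rewrite size_takel // size_drop so; lia.
  do 3 st.
  pose J2 j t'' s'' := [/\ j <= k /\ s'' bi 0 = j, s'' vv 0 = bin_val (take j bl) /\ s'' bp 0 = U i + j,
    t'' <= t' + 40 + 100 * j, s'' code 0 = cd i * 2 ^ j /\ s'' gg 0 = (g0 * 2 ^ U i + cd i) * 2 ^ j
    & forall y, y \notin [:: vv; bp; code; gg; bi] -> s'' y = s' y].
  apply: (@wp_for k J2 _ _ _ _ _ _ (t' + 40 + 100 * k)).
  - rewrite /J2; fin; rewrite ?take0 ?muln1 //; fin.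
    by move=> y y'; others y y'.
  - move=> j t'' s'' [[j1 j2] [j3 j4] j5 [j6 j7] j8]; fin.
    by rewrite (j8 12) // (j8 46) // i2 i9.
  - move=> j t'' s'' jk [[j1 j2] [j3 j4] j5 [j6 j7] j8].
    do 7 st; rewrite /J2; fin; rewrite ?j2 ?j3 ?j4 ?j6 ?j7 ?expnS; try lia.
      rewrite (take_nth false) ?szbl // bin_val_rcons -addnn (j8 35) // i10 (at_bool hb); last by lia.
      by rewrite /bl nth_take // nth_drop.
    by move=> y y'; others y y'; rewrite j8.
  move=> t'' s'' [[j1 j2] [j3 j4] j5 [j6 j7] j8] /=.
  rewrite -szbl take_size -blE in j3.
  apply: wp_seq.
  have w1 : wp (If $flag (vv ::= Add $vv (num @ $zp)) Skip)
      (fun t2 s2 => t2 <= t'' + 30 /\ s2 vv 0 = v x /\ (forall y, y \notin [:: vv] -> s2 y = s'' y))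
      (t'' + 7).+1 s''.
    have e := num_zeta (st_num st0) x q.
    rewrite (_ : v x = block_val ob x + fl * zeta x q) //.
    apply: wp_if => /=; rewrite (j8 40) // i11; case: (fl) => //= _; st.
      fin; first by rewrite (j8 2) // (j8 45) // i8 i4 xi -/x e j3 mul1n.
      by move=> y y'; others y y'.
    by fin; rewrite j3; lia.
  apply: wp_mono w1 _ => t2 s2 _ [k1 [k2 k3]].
  have kj y : y \notin [:: vv; bp; code; gg; bi] -> s2 y = s' y.
    by move=> y'; rewrite k3 ?j8 //; apply: contraNN y'; rewrite !inE => ->.
  do 9 st; rewrite /J; fin.
  all: rewrite ?k2 ?(k3 42) ?(k3 43) ?(k3 44) ?(kj 46) ?(kj 45) ?(kj 2) ?(kj 8) ?(kj 9) //.
  all: rewrite ?(kj 12) ?(kj 35) ?(kj 40) //.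
  all: have eB : s' 2 (s' 8 0 + s' 46 0) = beta x
    by rewrite i8 i12 hB i2 (num_beta (st_num st0) iX) xi nth_betas.
  all: rewrite ?eB ?i2 ?j4 ?j6 ?j7 ?i4 ?i8 ?n0 ?xi ?US ?cdS ?expnD /=; try lia.
  all: rewrite -/k ?mulnDl ?mulnA (_ : v x - (v x - beta x) = minn (v x) (beta x)) ?addnA //; lia. }
move=> t' s' [[i1 i2] [i3 i4] i5 [i6 i7] [i8 i9 i10 i11 i12]] /=.
by rewrite /R UX in i5 i7 *; rewrite cdK in i6 i7; fin.
Qed.

(** * The search graph *)

Definition init_node (A : automaton) : node A := (start A, cap (fun=> 0)).

(** That a computation never leaves [accept] is built into the edges, so [reach] needs no condition
    on intermediate nodes. *)
Inductive succ (A : automaton) : node A -> seq 'I_(nS A) -> node A -> Prop :=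
| succ_jump d xi :
    t_src (Delta d) <> accept A -> guard_sat (t_guard (Delta d)) xi ->
    succ (t_src (Delta d), xi) [::] (t_dst (Delta d), act (t_action (Delta d)) xi)
| succ_tick q xi :
    q <> accept A -> succ (q, xi) [:: lambda q] (q, elapse q 1 xi).

Inductive reach (A : automaton) : seq 'I_(nS A) -> node A -> Prop :=
| reach_init : reach [::] (init_node A)
| reach_succ u c l c' : reach u c -> succ c l c' -> reach (u ++ l) c'.

Lemma elapse0 (A : automaton) q (xi : assignment A) : elapse q 0 xi = xi.
Proof.
apply/ffunP => x; apply: val_inj; rewrite /= capE addn0 if_same.
by apply/minn_idPl; rewrite -ltnS.
Qed.

(** Capping after every unit step agrees with capping once at the end; hence a long delay is a
    sequence of ticks. *)
Lemma elapseS (A : automaton) q t (xi : assignment A) :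
  elapse q t.+1 xi = elapse q 1 (elapse q t xi).
Proof.
by apply/ffunP => x; apply: val_inj; rewrite /= !capE; case: ifP => _; lia.
Qed.

Lemma reach_elapse (A : automaton) u q (xi : assignment A) t :
  reach u (q, xi) -> q <> accept A ->
  reach (u ++ nseq t (lambda q)) (q, elapse q t xi).
Proof.
move=> r qa; elim: t => [|t IH]; first by rewrite cats0 elapse0.
rewrite -addn1 nseqD catA addn1 elapseS; apply: reach_succ IH _; exact: succ_tick.
Qed.

Lemma computation_reach (A : automaton) u (c : node A) s :
  reach u c -> computation c s ->
  reach (u ++ word_read c s) (last c [seq p.2 | p <- s]).
Proof.
elim: s u c => [|[t c'] s IH] u c r /=; first by rewrite cats0.
case=> ca e; rewrite catA; apply: IH.
case: e r ca => [d xi g|q xi {}t t0] r ca; last exact: reach_elapse.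
by rewrite cats0 -(cats0 u); apply: reach_succ r _; constructor.
Qed.

Lemma computation_rcons (A : automaton) (c : node A) s t c' :
  computation c s -> (last c [seq p.2 | p <- s]).1 <> accept A ->
  edge (last c [seq p.2 | p <- s]) t c' -> computation c (rcons s (t, c')).
Proof. by elim: s c => [|[t1 c1] s IH] c //= [ca e cs] la ed; split=> //; apply: IH. Qed.

Lemma word_read_rcons (A : automaton) (c : node A) s t c' :
  word_read c (rcons s (t, c')) =
  word_read c s ++ nseq t (lambda (last c [seq p.2 | p <- s]).1).
Proof. by elim: s c => [|[t1 c1] s IH] c /=; rewrite ?cats0 // IH catA. Qed.

Lemma lang_reach (A : automaton) u :
  lang u <-> exists2 c : node A, reach u c & c.1 = accept A.
Proof.
split=> [[s [cs la <-]]|[c r ca]].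
  by exists (last (init_node A) [seq p.2 | p <- s]) => //; apply: (computation_reach (u := [::])) => //; constructor.
suff [s [h1 h2 h3]] : exists s, [/\ computation (init_node A) s,
    last (init_node A) [seq p.2 | p <- s] = c & word_read (init_node A) s = u].
  by exists s; rewrite h2.
elim: {c ca} r => [|{}u c l c' _ [s [h1 h2 h3]] st]; first by exists [::].
have ca : c.1 <> accept A by case: st.
(* The duration of the edge is the length of its label: 0 for a jump, 1 for a tick. *)
exists (rcons s (size l, c')); rewrite word_read_rcons map_rcons last_rcons h2 h3.
split=> //; first apply: computation_rcons => //; rewrite ?h2 //.
  by case: st => *; constructor.
by case: st.
Qed.

(** * Words compatible with the input, their costs, and the abstract search *)

Section Search.

Variables (A : automaton) (w : seq 'I_(nS A)) (a : 'I_(nS A)) (n : nat).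

Let N := size w + n.

(** Both sides are cut to the shorter length: one of [u] and [w] is a prefix of the other. *)
Definition valid (u : seq 'I_(nS A)) : Prop :=
  size u <= N /\ take (size u) w = take (size w) u.

Definition cost (u : seq 'I_(nS A)) : nat := count (predC1 a) (drop (size w) u).

(** [evalid] and [ecost] are the contributions of an edge to [valid] and [cost]. They depend on the
    word read so far only through its length [j], which is why a configuration need not remember
    more than [j]. *)
Definition evalid (j : nat) (l : seq 'I_(nS A)) : Prop :=
  j + size l <= N /\ take (size l) (drop j w) = take (size w - j) l.

Definition ecost (j : nat) (l : seq 'I_(nS A)) : nat :=
  count (predC1 a) (drop (size w - j) l).

Lemma cost_cat u l : cost (u ++ l) = cost u + ecost (size u) l.
Proof.
rewrite /cost /ecost drop_cat; case: ltnP => h; first by rewrite count_cat (eqP (_ : size w - size u == 0)) ?drop0 //; lia.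
by rewrite (drop_oversize h).
Qed.

Lemma valid_cat u l : valid (u ++ l) <-> valid u /\ evalid (size u) l.
Proof.
rewrite /valid /evalid size_cat.
have -> : take (size u + size l) w = take (size u) w ++ take (size l) (drop (size u) w).
  by rewrite takeD.
have -> : take (size w) (u ++ l) = take (size w) u ++ take (size w - size u) l.
  by rewrite take_cat; case: ltnP => h; [rewrite (eqP (_ : size w - size u == 0)) ?take0 ?cats0 //; lia | rewrite (take_oversize h)].
split=> [[h1 /eqP]|[[h1 h2] [h3 h4]]]; last by rewrite h2 h4.
rewrite eqseq_cat; last by rewrite !size_take_min minnC.
by case/andP => /eqP -> /eqP ->; split; split=> //; lia.
Qed.

Lemma valid_nil : valid [::].
Proof. by split=> //=; rewrite take0. Qed.

Lemma extension_valid v : extension w n v <->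
  exists2 c : node A, reach (w ++ v) c & c.1 = accept A /\ size (w ++ v) = N.
Proof.
rewrite /extension lang_reach size_cat /N.
by split=> [[e [c r ca]]|[c r [ca e]]]; [exists c => //; rewrite e | split; [lia | exists c]].
Qed.

Lemma valid_catl v : size v = n -> valid (w ++ v).
Proof.
move=> sv; split; first by rewrite size_cat sv.
by rewrite size_cat take_size_cat // take_oversize // leq_addr.
Qed.

Lemma valid_split u : valid u -> size u = N -> exists2 v, u = w ++ v & size v = n.
Proof.
move=> [_ e] su; exists (drop (size w) u); last by rewrite size_drop su /N addKn.
by rewrite -{1}(cat_take_drop (size w) u) -e take_oversize // su leq_addr.
Qed.

Lemma cost_catl v : cost (w ++ v) + count_mem a v = size v.
Proof. by rewrite /cost drop_size_cat // addnC count_predC. Qed.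

(** The state of the search without the memory: all entries ever made (word, node, parent), the two
    stacks of entry numbers, the visited configurations with the cost of their visit, and the
    current cost. The words are kept only here; the memory holds their lengths, and parent pointers
    from which the answer is recovered. *)
Record search := Search {
  ents : seq (seq 'I_(nS A) * node A * nat);
  ch : seq nat;
  nh : seq nat;
  vis : seq (nat * node A * nat);
  lev : nat
}.

(** Entries are numbered from 1, so that 0 is the null pointer and the parent of the root. *)
Definition ent (G : search) (e : nat) := nth ([::], init_node A, 0) (ents G) e.-1.
Definition wrd G e := (ent G e).1.1.
Definition nod G e := (ent G e).1.2.
Definition par G e := (ent G e).2.
Definition cfg G e := (size (wrd G e), nod G e).
Definition isid (G : search) e := 0 < e <= size (ents G).

(** The configuration is known at a cost of at most [k]: it was visited, or it is pending on the
    stack of cost [lev G] or of cost [(lev G).+1]. All operations of the search preserve this. *)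
Definition covered (G : search) (j : nat) (c : node A) (k : nat) : Prop :=
  [\/ exists2 l, (j, c, l) \in vis G & l <= k,
      (exists2 e, e \in ch G & cfg G e = (j, c)) /\ lev G <= k |
      (exists2 e, e \in nh G & cfg G e = (j, c)) /\ lev G < k].

Definition closed_at (G : search) (v : nat * node A * nat) : Prop :=
  forall l c', succ v.1.2 l c' -> evalid v.1.1 l ->
    covered G (v.1.1 + size l) c' (v.2 + ecost v.1.1 l).

(* [D] is the part of [vis] whose successors are already known. *)
Record search_inv (G : search) (D : seq (nat * node A * nat)) : Prop := Inv {
  inv_ids : forall e, (e \in ch G) || (e \in nh G) -> isid G e;
  inv_ent : forall e, isid G e -> reach (wrd G e) (nod G e) /\ valid (wrd G e);
  inv_par : forall e, isid G e -> par G e = 0 /\ wrd G e = [::] \/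
    0 < par G e < e /\ exists2 l, succ (nod G (par G e)) l (nod G e) & wrd G e = wrd G (par G e) ++ l;
  inv_ch : forall e, e \in ch G -> cost (wrd G e) = lev G;
  inv_nh : forall e, e \in nh G -> cost (wrd G e) = (lev G).+1;
  inv_vis : forall v, v \in vis G ->
    [/\ v.2 <= lev G, v.1.1 <= N & ~ (v.1.1 = N /\ v.1.2.1 = accept A)];
  inv_uniq : uniq (map fst (vis G));
  inv_start : covered G 0 (init_node A) 0;
  inv_closed : forall v, v \in D -> closed_at G v
}.

(** Induction along the path, with every visited configuration closed. Pending entries cost at least
    [lev G], so on a path of smaller cost, or on any path once the stacks are empty, [covered]
    leaves only the alternative of a visit. *)
Lemma inv_complete G u c : search_inv G (vis G) -> reach u c -> valid u ->
  cost u < lev G \/ (ch G = [::] /\ nh G = [::]) ->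
  exists2 l, (size u, c, l) \in vis G & l <= cost u.
Proof.
move=> I r; elim: r => [|{}u {}c l c' r IH st].
  move=> _ h; have := inv_start I; case=> [[k k1 k2]|[[e e1 e2] k]|[[e e1 e2] k]].
  - by exists k => //; rewrite (leq_trans k2).
  - by case: h => [|[h _]]; [rewrite /cost; case: (size w) => /=; lia | rewrite h in e1].
  - by case: h => [|[_ h]]; [rewrite /cost; case: (size w) => /=; lia | rewrite h in e1].
move=> /valid_cat[v1 v2] h; rewrite cost_cat in h *; rewrite size_cat.
have [k k1 k2] : exists2 k, (size u, c, k) \in vis G & k <= cost u.
  by apply: IH => //; case: h => h; [left; lia | right].
have := inv_closed I k1 st v2; rewrite /=; case=> [[k' k3 k4]|[[e e1 e2] k4]|[[e e1 e2] k4]].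
- by exists k' => //; lia.
- by case: h => [|[h _]]; [lia | rewrite h in e1].
- by case: h => [|[_ h]]; [lia | rewrite h in e1].
Qed.

(** An extension would lead to an accepting configuration of layer [N]; by completeness it would be
    visited, which the invariant excludes. *)
Lemma no_extension G : search_inv G (vis G) -> ch G = [::] -> nh G = [::] ->
  ~ exists v, extension w n v.
Proof.
move=> I c1 n1 [v /extension_valid[c r [ca sv]]].
have [||k k1 _] := inv_complete I r; [|by right|].
  by apply: valid_catl; move: sv; rewrite size_cat /N; lia.
by have [_ _] := inv_vis I k1; apply.
Qed.

(** A better extension would cost less than [lev G], so its accepting configuration of layer [N]
    would be visited already, against the invariant. *)
Lemma best_entry G e : search_inv G (vis G) -> isid G e -> cost (wrd G e) = lev G ->
  size (wrd G e) = N -> (nod G e).1 = accept A ->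
  best_extension w a n (drop (size w) (wrd G e)).
Proof.
move=> I ie ce se ae; have [r va] := inv_ent I ie.
have [v uv sv] := valid_split va se; rewrite uv drop_size_cat //.
split; first by apply/extension_valid; exists (nod G e); rewrite -uv.
move=> v' /extension_valid[c r' [ca sv']].
have sv2 : size v' = n by move: sv'; rewrite size_cat /N; lia.
rewrite leqNgt; apply/negP => lt.
have lt2 : cost (w ++ v') < lev G.
  by rewrite -ce uv; have := cost_catl v; have := cost_catl v'; lia.
have [k k1 _] := inv_complete I r' (valid_catl sv2) (or_introl lt2).
by have [_ _] := inv_vis I k1; apply.
Qed.

Definition start_search : search :=
  Search [:: ([::], init_node A, 0)] [:: 1] [::] [::] 0.

Lemma inv_start_search : search_inv start_search [::].
Proof.
split=> //.
- by move=> e; rewrite inE orbF => /eqP ->.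
- move=> [|[|e]] //= _; rewrite /wrd /nod /ent /=; split; [constructor|exact: valid_nil].
- by move=> [|[|e]] //= _; left.
- by move=> e; rewrite inE => /eqP ->; rewrite /wrd /ent /= /cost; case: (size w).
- by apply: Or32; split=> //; exists 1.
Qed.

Definition swap G := Search (ents G) (nh G) [::] (vis G) (lev G).+1.

(** With the current stack empty, raising the level turns the third alternative of [covered] into
    the second. *)
Lemma inv_swap G D : ch G = [::] -> search_inv G D -> search_inv (swap G) D.
Proof.
move=> c0 [h1 h2 h3 h4 h5 h6 h7 h8 h9].
have cov j c k : covered G j c k -> covered (swap G) j c k.
  by case=> [? | [[e]] | [? ?]]; [apply: Or31 | rewrite c0 | apply: Or32].
split=> //=.
- by move=> e; rewrite orbF => en; apply: h1; rewrite en orbT.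
- by move=> v /h6[k1 k2 k3]; split=> //; apply: leqW.
- exact: cov.
by move=> v vD l c' st ev; apply: cov; apply: h9.
Qed.

Definition pop G := Search (ents G) (behead (ch G)) (nh G) (vis G) (lev G).

(** The entry may be dropped because its configuration was visited at a level not above the present
    one. *)
Lemma inv_pop G D e : ohead (ch G) = Some e -> cfg G e \in map fst (vis G) ->
  search_inv G D -> search_inv (pop G) D.
Proof.
case ce: (ch G) => [|e' r] //= [ee]; subst e'.
move=> /mapP[[jc k] kv je] [h1 h2 h3 h4 h5 h6 h7 h8 h9].
have cov j c k' : covered G j c k' -> covered (pop G) j c k'.
  case=> [? | [[e']] | [? ?]]; [by apply: Or31 | | by apply: Or33].
  rewrite /pop /covered /= ce inE => /orP[/eqP ->|e'r] cc kk; last by apply: Or32; split=> //; exists e'.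
  apply: Or31; exists k; last by have [k1 _ _] := h6 _ kv; apply: leq_trans k1 kk.
  by rewrite -cc je.
split=> //=.
- by move=> e1; rewrite ce /= => h; apply: h1; rewrite ce inE -orbA h orbT.
- by move=> e1; rewrite ce /= => h; apply: h4; rewrite ce inE h orbT.
- exact: cov.
by move=> v vD l c' st ev; apply: cov; apply: h9.
Qed.

Definition visit G e :=
  Search (ents G) (behead (ch G)) (nh G) ((cfg G e, lev G) :: vis G) (lev G).

(** [D] does not grow here: the new configuration is closed only after its expansion. *)
Lemma inv_visit G D e : ohead (ch G) = Some e -> cfg G e \notin map fst (vis G) ->
  ~ (size (wrd G e) = N /\ (nod G e).1 = accept A) ->
  search_inv G D -> search_inv (visit G e) D.
Proof.
case ce: (ch G) => [|e' r] //= [ee]; subst e'.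
move=> nv na [h1 h2 h3 h4 h5 h6 h7 h8 h9].
have cov j c k' : covered G j c k' -> covered (visit G e) j c k'.
  case=> [[k kv kk] | [[e']] | [? ?]]; [by apply: Or31; exists k; rewrite // inE kv orbT | | by apply: Or33].
  rewrite /covered /= ce inE => /orP[/eqP ->|e'r] cc kk; last by apply: Or32; split=> //; exists e'.
  by apply: Or31; exists (lev G) => //; rewrite cc inE eqxx.
have ie : isid G e by apply: h1; rewrite ce inE eqxx.
split=> //=.
- by move=> e1; rewrite ce /= => h; apply: h1; rewrite ce inE -orbA h orbT.
- by move=> e1; rewrite ce /= => h; apply: h4; rewrite ce inE h orbT.
- move=> v; rewrite inE => /orP[/eqP -> /=|/h6 //]; split=> //.
  by have [_ []] := h2 _ ie.
- by rewrite nv.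
- exact: cov.
by move=> v vD l c' st ev; apply: cov; apply: h9.
Qed.

Definition push G e l c' (b : bool) :=
  let i := (size (ents G)).+1 in
  Search (rcons (ents G) (wrd G e ++ l, c', e))
    (if b then ch G else i :: ch G) (if b then i :: nh G else nh G) (vis G) (lev G).

Lemma ent_push G e l c' b i : i <= size (ents G) -> 0 < size (ents G) ->
  ent (push G e l c' b) i = ent G i.
Proof. by move=> iG G0; rewrite /ent /= nth_rcons; case: ltnP => //; lia. Qed.

Lemma ent_push_new G e l c' b :
  ent (push G e l c' b) (size (ents G)).+1 = (wrd G e ++ l, c', e).
Proof. by rewrite /ent /= nth_rcons ltnn eqxx. Qed.

Lemma covered_push G D e l c' b j c k : search_inv G D -> covered G j c k ->
  covered (push G e l c' b) j c k.
Proof.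
move=> I; have id i : isid G i -> cfg (push G e l c' b) i = cfg G i.
  by case/andP=> i0 iG; rewrite /cfg /wrd /nod !ent_push //; lia.
case=> [?|[[i i1 i2] kk]|[[i i1 i2] kk]]; first by apply: Or31.
  apply: Or32; split=> //; exists i; first by rewrite /=; case: ifP => _; rewrite // inE i1 orbT.
  by rewrite id //; apply: (inv_ids I); rewrite i1.
apply: Or33; split=> //; exists i; first by rewrite /=; case: ifP => _; rewrite // inE i1 orbT.
by rewrite id //; apply: (inv_ids I); rewrite i1 orbT.
Qed.

Lemma covered_push_new G e l c' b :
  covered (push G e l c' b) (size (wrd G e) + size l) c' (lev G + b).
Proof.
have E : cfg (push G e l c' b) (size (ents G)).+1 = (size (wrd G e) + size l, c').
  by rewrite /cfg /wrd /nod ent_push_new /= size_cat.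
case: b E => E; [apply: Or33 | apply: Or32]; split; rewrite ?addn1 ?addn0 //;
  by exists (size (ents G)).+1; rewrite //= inE eqxx.
Qed.

Lemma inv_push G D e l c' (b : bool) : search_inv G D -> isid G e ->
  cost (wrd G e) = lev G -> succ (nod G e) l c' -> evalid (size (wrd G e)) l ->
  ecost (size (wrd G e)) l = b -> search_inv (push G e l c' b) D.
Proof.
move=> I ie ce st ev eb.
have cp j0 c0 k0 : covered G j0 c0 k0 -> covered (push G e l c' b) j0 c0 k0 by apply: covered_push I.
case: (I) => h1 h2 h3 h4 h5 h6 h7 h8 h9.
have id i : isid G i -> ent (push G e l c' b) i = ent G i.
  by case/andP=> i0 iG; rewrite ent_push //; lia.
have new i : isid (push G e l c' b) i -> isid G i \/ i = (size (ents G)).+1.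
  by rewrite /isid /= size_rcons; case: (eqVneq i (size (ents G)).+1) => [->|ni] h; [right | left; lia].
have old i : isid G i -> isid (push G e l c' b) i.
  by rewrite /isid /= size_rcons; lia.
have nid : isid (push G e l c' b) (size (ents G)).+1 by rewrite /isid /= size_rcons leqnn.
have cn : cost (wrd G e ++ l) = lev G + b by rewrite cost_cat ce eb.
split=> //.
- move=> i /= ii; have : (i == (size (ents G)).+1) || ((i \in ch G) || (i \in nh G)).
    by move: ii; case: (b); rewrite inE //; case: (i \in ch G); case: (i == _).
  by case/orP => [/eqP ->|/h1/old].
- move=> i /new[ii|->]; rewrite /wrd /nod; first by rewrite id //; apply: h2.
  rewrite ent_push_new.
  have [r v] := h2 _ ie; split; first exact: (reach_succ r st).
  by apply/valid_cat.
- move=> i /new[ii|->]; rewrite /wrd /nod /par.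
    rewrite id //; case: (h3 _ ii) => [|[pi [l' s1 s2]]]; first by left.
    have pid : isid G (par G i) by move: pi ii; rewrite /isid; lia.
    by right; split=> //; exists l'; rewrite id.
  by rewrite ent_push_new; right; rewrite id //; split=> //; exists l.
- have o i : i \in ch G -> cost (wrd (push G e l c' b) i) = lev G.
    by move=> ii; rewrite /wrd id ?h4 //; apply: h1; rewrite ii.
  move=> i /=; case: (b) cn o => //= cn o; first exact: o.
  by rewrite inE => /orP[/eqP ->|/o //]; rewrite /wrd ent_push_new cn addn0.
- have o i : i \in nh G -> cost (wrd (push G e l c' b) i) = (lev G).+1.
    by move=> ii; rewrite /wrd id ?h5 //; apply: h1; rewrite ii orbT.
  move=> i /=; case: (b) cn o => //= cn o; last exact: o.
  by rewrite inE => /orP[/eqP ->|/o //]; rewrite /wrd ent_push_new cn addn1.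
- exact: cp.
by move=> v vD l' c1 st' ev'; apply: cp; apply: h9.
Qed.

End Search.

(** * Search states in memory *)

Notation cur := 20 (only parsing).
Notation tonh := 22 (only parsing).
Notation aJ := 50 (only parsing).
Notation aB := 51 (only parsing).
Notation aQ := 52 (only parsing).
Notation aC := 53 (only parsing).
Notation aG := 54 (only parsing).
Notation aP := 55 (only parsing).
Notation aL := 56 (only parsing).
Notation aV := 57 (only parsing).
Notation hc := 58 (only parsing).
Notation hn := 59 (only parsing).
Notation nent := 60 (only parsing).
Notation found := 61 (only parsing).
Notation pj := 62 (only parsing).
Notation pb := 63 (only parsing).

Definition push_entry : prog :=
  nent ::= Add $nent (Const 1) ;;
  Store aJ $nent $pj ;;
  Store aB $nent $pb ;;
  Store aQ $nent $qq ;;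
  Store aC $nent $code ;;
  Store aG $nent $gg ;;
  Store aP $nent $cur ;;
  If $tonh (Store aL $nent $hn ;; hn ::= $nent)
    (Store aL $nent $hc ;; hc ::= $nent).

Fixpoint linked (f : nat -> nat) (h : nat) (l : seq nat) : Prop :=
  if l is e :: l' then h = e /\ linked f (f e) l' else h = 0.

Lemma linked_setf f h l i v : i \notin l -> linked f h l -> linked (setf f i v) h l.
Proof.
elim: l h => //= e l IH h; rewrite inE negb_or => /andP[ie il] [-> le]; split=> //.
by rewrite setf_neq 1?eq_sym //; apply: IH.
Qed.

(** Mixed-radix notation with digits layer, state and code. The last radix is a power of two, not
    the number of assignments, so that doublings suffice to compute the index. *)
Definition idx (A : automaton) (j : nat) (c : node A) : nat :=
  (j * nQ A + c.1) * 2 ^ nbits A + code_of c.2.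

Lemma mulnD_inj k x x' r r' :
  r < k -> r' < k -> x * k + r = x' * k + r' -> x = x' /\ r = r'.
Proof.
move=> rk rk' e; have k0 : 0 < k by apply: leq_ltn_trans rk.
split; first by have := congr1 (divn^~ k) e; rewrite !divnMDl // !divn_small // !addn0.
by have := congr1 (modn^~ k) e; rewrite !modnMDl !modn_small.
Qed.

Lemma idx_inj (A : automaton) j j' (c c' : node A) :
  idx j c = idx j' c' -> (j, c) = (j', c').
Proof.
case: c c' => [q xi] [q' xi'] /(mulnD_inj (code_lt xi) (code_lt xi'))[/=].
by move=> /(mulnD_inj (ltn_ord q) (ltn_ord q'))[-> /val_inj ->] /code_inj ->.
Qed.

(** [aB] and [aG] store values that would otherwise need a multiplication. One array of links serves
    both stacks, since an entry lies on at most one of them. *)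
Record rep (A : automaton) (s : memory) (G : search A) : Prop := Rep {
  rep_cnt : s nent 0 = size (ents G);
  rep_ent : forall e, isid G e ->
    [/\ s aJ e = size (wrd G e), s aB e = size (wrd G e) * nQ A,
        s aQ e = (nod G e).1, s aC e = code_of (nod G e).2
      & s aG e = idx (size (wrd G e)) (nod G e) /\ s aP e = par G e];
  rep_ch : linked (s aL) (s hc 0) (ch G);
  rep_nh : linked (s aL) (s hn 0) (nh G);
  rep_vis : forall j c, s aV (idx j c) = nat_of_bool ((j, c) \in map fst (vis G))
}.

Lemma range_off lo hi l y :
  all (fun z => (z < lo) || (hi < z)) l -> lo <= y <= hi -> (y \in l) = false.
Proof.
move=> /allP h yy; apply/negbTE/negP => /h; lia.
Qed.

Lemma rep_frame (A : automaton) s s' (G : search A) :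
  (forall y, 50 <= y <= 60 -> s' y = s y) -> rep s G -> rep s' G.
Proof.
by move=> f [*]; split; rewrite ?f.
Qed.

Lemma static_frame (A : automaton) w a n s s' :
  (forall y, 2 <= y <= 13 -> s' y = s y) -> @static A w a n s -> @static A w a n s'.
Proof. by move=> f [*]; split; rewrite ?f // => i ?; rewrite f //; auto. Qed.

Lemma wp_push (A : automaton) (G : search A) e (l : seq 'I_(nS A)) (c' : node A) (b : bool)
    (Q : nat -> memory -> Prop) t s :
  rep s G -> isid G e ->
  (forall i, (i \in ch G) || (i \in nh G) -> isid G i) ->
  s cur 0 = e -> s pj 0 = size (wrd G e) + size l ->
  s pb 0 = (size (wrd G e) + size l) * nQ A ->
  s qq 0 = c'.1 -> s code 0 = code_of c'.2 ->
  s gg 0 = idx (size (wrd G e) + size l) c' -> s tonh 0 = b ->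
  (forall t' s', framed push_entry s s' -> t' <= t + 100 ->
     rep s' (push G e l c' b) -> Q t' s') ->
  wp push_entry Q t s.
Proof.
move=> [h1 h2 h3 h4 h5] ie ids sc sj sb sq sk sg st h.
pose R t' s' := t' <= t + 100 /\ rep s' (push G e l c' b).
suff wR : wp push_entry R t s by apply: wp_mono wR _ => t' s' fr []; apply: h.
do 14 st; mem; rewrite /= !setf_eq h1 (addn1 (size _)) sj sb sq sk sg sc.
set i := (size (ents G)).+1.
(* The new number is on neither stack, so writing its link leaves both lists intact. *)
have ni x : (x \in ch G) || (x \in nh G) -> x != i.
  by move/ids; rewrite /isid /i; lia.
have nc : i \notin ch G by apply/negP => ii; have := ni i; rewrite ii eqxx => /(_ isT).
have nn : i \notin nh G by apply/negP => ii; have := ni i; rewrite ii eqxx orbT => /(_ isT).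
have new i' : isid (push G e l c' b) i' ->
    isid G i' /\ i' != i /\ ent (push G e l c' b) i' = ent G i' \/
    i' = i /\ ent (push G e l c' b) i' = (wrd G e ++ l, c', e).
  rewrite {1}/isid /= size_rcons => ii.
  case: (eqVneq i' i) => [->|ne]; first by right; rewrite ent_push_new.
  left; have ig : isid G i' by rewrite /isid; move: ne; rewrite /i; lia.
  by split=> //; split=> //; rewrite ent_push //; move: ig; rewrite /isid; lia.
rewrite /R {R h}; apply: wp_if => /=; mem; rewrite /= st; case: b {st} new => // new _; do 3 st.
all: split; first by mem; lia.
all: split; mem; rewrite /= ?setf_eq ?size_rcons //; try by [apply: linked_setf | split=> //; apply: linked_setf].
all: move=> i' /new[[ii [ne ee]]|[-> ee]]; rewrite /wrd /nod /par ee.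
all: by rewrite ?setf_eq ?setf_neq ?size_cat //; apply: h2.
Qed.

(** * Expanding a configuration *)

Notation itr := 26 (only parsing).
Notation src := 27 (only parsing).
Notation gb := 28 (only parsing).
Notation cq := 29 (only parsing).
Notation ok := 36 (only parsing).

Definition emit : prog := gg ::= Add $pb $qq ;; pack ;; push_entry.

(** Both circuits are evaluated even if the transition does not apply, because this moves [ptr] to
    the next transition. The value of the guard is saved in [gb] before the action overwrites
    [obits]. *)
Definition trans_step : prog :=
  src ::= num @ $ptr ;;
  qq ::= num @ (Add $ptr (Const 1)) ;;
  ptr ::= Add $ptr (Const 2) ;;
  circ (Const 1) ;;
  gb ::= obits @ (Const 0) ;;
  circ $mm ;;
  If $gb
    (If (neq $src $cq) Skip
       (flag ::= Const 0 ;; tonh ::= Const 0 ;;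
        pj ::= aJ @ $cur ;; pb ::= aB @ $cur ;; emit))
    Skip.

(** Inside [w] the letter of the state must be the one at position [j], cell 2 + j of [wd], and is
    free; beyond [w] any letter is allowed and costs 1 unless it is [a]. Here 1 - (1 - x) turns a
    distance into a bit. The bits of the assignment are copied to [obits] so that [pack] can do the
    time step. *)
Definition tick : prog :=
  If (Minus $len (aJ @ $cur))
    (If (Minus $lenw (aJ @ $cur))
       (tonh ::= Const 0 ;;
        ok ::= Minus (Const 1)
          (neq (num @ (Add (Const 6) $cq)) (wd @ (Add (Const 2) (aJ @ $cur)))))
       (tonh ::= Minus (Const 1)
          (Minus (Const 1) (neq (num @ (Add (Const 6) $cq)) (wd @ (Const 0)))) ;;
        ok ::= Const 1) ;;
     If $ok
       (For ui $mm (Store obits $ui (bits @ $ui)) ;;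
        flag ::= Const 1 ;; qq ::= $cq ;;
        pj ::= Add (aJ @ $cur) (Const 1) ;;
        pb ::= Add (aB @ $cur) (num @ (Const 0)) ;; emit)
       Skip)
    Skip.

Definition expand : prog :=
  cq ::= aQ @ $cur ;; cc ::= aC @ $cur ;; unpack ;;
  ptr ::= $bTrans ;;
  For itr (num @ (Const 3)) trans_step ;;
  tick.

Lemma cap_ext (A : automaton) (v v' : 'I_(nX A) -> nat) : v =1 v' -> cap v = cap v'.
Proof. by move=> e; apply/ffunP => x; apply: val_inj; rewrite /= !capE e. Qed.

Lemma block_val_bits (A : automaton) (xi : assignment A) x :
  block_val (assignment_bits xi) x = xi x.
Proof.
rewrite /block_val -/(widths A) /assignment_bits -(shape_blocks (fun x => val (xi x))).
rewrite flattenK (nth_map x) ?size_enum_ord // nth_ord_enum bin_val_bin //.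
by apply: leq_trans (ltn_ord _) _; apply: ltn_width.
Qed.

Section Expand.

Variables (A : automaton) (w : seq 'I_(nS A)) (a : 'I_(nS A)) (n : nat).

Lemma wp_emit (G : search A) e (l : seq 'I_(nS A)) q' (b fl : bool) ob D
    (Q : nat -> memory -> Prop) t s :
  static w a n s -> rep s G -> search_inv w a n G D -> isid G e ->
  size ob = nbits A -> at_ (s obits) 0 (map nat_of_bool ob) ->
  s flag 0 = fl -> s cur 0 = e -> s pj 0 = size (wrd G e) + size l ->
  s pb 0 = (size (wrd G e) + size l) * nQ A ->
  s qq 0 = nat_of_ord q' -> s tonh 0 = b ->
  (forall t' s', framed emit s s' -> t' <= t + 250 + 200 * (nX A + nbits A) ->
     rep s' (push G e l (q', cap (fun x => block_val ob x + fl * zeta x q')) b) -> Q t' s') ->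
  wp emit Q t s.
Proof.
move=> st0 r0 I ie so hb hf hc hj hB hq ht h.
set c' := (q', _) in h.
pose R t' s' := t' <= t + 250 + 200 * (nX A + nbits A) /\ rep s' (push G e l c' b).
suff wR : wp emit R t s by apply: wp_mono wR _ => t' s' fr []; apply: h.
do 3 st; set s1 := update _ _ _ _; rewrite /= hB hq in s1 *.
have f1 y : (y == gg) = false -> s1 y = s y by apply: update_other.
have st1 : static w a n s1 by apply: static_frame st0 => y yy; apply: f1; lia.
have g1 : s1 gg 0 = (size (wrd G e) + size l) * nQ A + q' by rewrite /s1; memr.
apply: (wp_pack (q := q') (fl := fl) (ob := ob) (g0 := (size (wrd G e) + size l) * nQ A + q') st1) => //; try by rewrite f1.
move=> t2 s2 fr2 /= t2le e1 e2; apply: (wp_push (e := e) (l := l) (c' := c') (b := b) (G := G)).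
all: rewrite ?(fr2 20) ?(fr2 62) ?(fr2 63) ?(fr2 41) ?(fr2 22) ?f1 //.
- apply: rep_frame r0 => y yy; rewrite fr2; first by apply: f1; lia.
  exact: range_off yy.
- exact: (inv_ids I).
by move=> t3 s3 _ t3le r3; split=> //; lia.
Qed.

(** The size conditions feed the clock: pending entries increase by no more than the new entries, of
    which there are at most [k]. *)
Definition extends (G G' : search A) e k : Prop :=
  [/\ isid G' e /\ ent G' e = ent G e, vis G' = vis G, lev G' = lev G,
      size (ch G') + size (nh G') + size (ents G) <= size (ch G) + size (nh G) + size (ents G') /\
      size (ents G') <= size (ents G) + k
    & forall j c i, covered G j c i -> covered G' j c i].

Lemma extends0 G e k : isid G e -> extends G G e k.
Proof. by move=> ie; split=> //; lia. Qed.

Lemma extends_trans G1 G2 G3 e k1 k2 :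
  extends G1 G2 e k1 -> extends G2 G3 e k2 -> extends G1 G3 e (k1 + k2).
Proof.
move=> [[a1 a2] a3 a4 a5 a6] [[b1 b2] b3 b4 b5 b6]; split; try congruence; try lia.
  by split; congruence.
by move=> j c i /a6/b6.
Qed.

Lemma extends_push G D e l c' b : search_inv w a n G D -> isid G e ->
  extends G (push G e l c' b) e 1.
Proof.
move=> I ie; have /andP[e0 eG] := ie; split=> //.
- split; first by rewrite /isid /= size_rcons; lia.
  by rewrite ent_push //; lia.
- by rewrite /= size_rcons; case: b => /=; lia.
by move=> j c i; apply: covered_push I.
Qed.

(** [k] is the length of the code of the transition; it covers the assignment bits, as the action
    lists one output per bit. The stopwatches are charged separately because [pack] spends a round
    even on a block of width 0, that is, on a stopwatch with bound 0. *)
Definition trans_time (k : nat) := 600 * (k + nX A + 1).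

Lemma wp_trans_step (G : search A) D e q xi (d : 'I_(nD A)) p
    (Q : nat -> memory -> Prop) t s :
  static w a n s -> rep s G -> search_inv w a n G D -> isid G e ->
  nod G e = (q, xi) -> q <> accept A -> cost w a (wrd G e) = lev G ->
  valid w n (wrd G e) ->
  s cur 0 = e -> s cq 0 = q -> at_ (s bits) 0 (map nat_of_bool (assignment_bits xi)) ->
  s ptr 0 = p -> at_ (s num) p (transition_nats (Delta d)) ->
  (forall t' s' G', framed trans_step s s' ->
     t' <= t + trans_time (size (transition_nats (Delta d))) ->
     s' ptr 0 = p + size (transition_nats (Delta d)) ->
     rep s' G' -> search_inv w a n G' D -> extends G G' e 1 ->
     (t_src (Delta d) = q -> guard_sat (t_guard (Delta d)) xi ->
        covered G' (size (wrd G e)) (t_dst (Delta d), act (t_action (Delta d)) xi) (lev G)) ->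
     Q t' s') ->
  wp trans_step Q t s.
Proof.
move=> st0 r0 I ie ne qa ce ve hc hq hb hp hn h.
set T := Delta d in hn h *.
pose R t' s' := exists G', [/\ t' <= t + trans_time (size (transition_nats T)) /\
     s' ptr 0 = p + size (transition_nats T), rep s' G', search_inv w a n G' D, extends G G' e 1 &
     (t_src T = q -> guard_sat (t_guard T) xi ->
        covered G' (size (wrd G e)) (t_dst T, act (t_action T) xi) (lev G))].
suff wR : wp trans_step R t s.
  by apply: wp_mono wR _ => t' s' fr [G' [[k1 k2] k3 k4 k5 k6]]; apply: (h t' s' G').
move: hn; rewrite /transition_nats at_cons at_cons at_cat => -[n0 [n1 [n2 n3]]].
do 6 st; set s1 := update _ _ _ _; rewrite /= hp in s1 *.
have f1 y : y \notin [:: src; qq; ptr] -> s1 y = s y by move=> y'; rewrite /s1; others y y'.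
have sb := size_assignment_bits xi.
have q1 : s1 qq 0 = t_dst T by rewrite /s1; memr; rewrite hp addn1 n1.
have u1 : s1 src 0 = t_src T by rewrite /s1; memr.
have p1 : s1 ptr 0 = p.+2 by rewrite /s1; memr; lia.
st; apply: (@wp_circ _ _ (t_guard T) (assignment_bits xi) (Const 1) _ _ _ s1 sb _ p1) => //.
move=> t2 s2 fr2 t2le o2 p2; do 3 st; set s3 := update _ _ _ _; rewrite /= in s3 *.
have m2 := st_mm st0.
have f3 y : y \notin gb :: mods (circ (Const 1)) -> s3 y = s1 y.
  move=> y'; rewrite /s3; others y y'; apply: fr2.
  by move: y'; rewrite in_cons negb_or => /andP[_ /negbTE].
have g3 : s3 gb 0 = guard_sat (t_guard T) xi.
  rewrite /s3; memr; rewrite /guard_sat; have := @o2 0; rewrite /circuit_eval add0n.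
  by case: (outs (t_guard T)) => -[|x [|y r]] //= _ /(_ isT) ->; case: nth.
apply: (@wp_circ _ _ (t_action T) (assignment_bits xi) $mm _ _ _ s3 sb _ _) => //.
- by rewrite f3 // f1.
- rewrite f3 // f1 // (_ : s3 23 0 = s2 23 0); last by rewrite /s3; mem.
  by rewrite p2.
- by move=> s' e'; rewrite /= e' f3 // f1.
move=> t4 s4 fr4 t4le o4 p4.
have f4 y : y \notin gb :: mods (circ (Const 1)) -> s4 y = s1 y.
  move=> y'; rewrite fr4 ?f3 //; move: y'; rewrite in_cons negb_or => /andP[_ /negbTE].
  by [].
have e4 : s4 gb 0 = guard_sat (t_guard T) xi by rewrite (fr4 28).
have r4 : rep s4 G by apply: rep_frame r0 => y yy; rewrite f4 ?f1 //; apply/negbT/(range_off _ yy).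
have st4 : static w a n s4 by apply: static_frame st0 => y yy; rewrite f4 ?f1 //; apply/negbT/(range_off _ yy).
have p4' : s4 ptr 0 = p.+2 + size (circuit_nats (t_guard T)) + size (circuit_nats (t_action T)).
  by rewrite p4 /s3; memr; rewrite p2.
have sz : size (transition_nats T) =
    size (circuit_nats (t_guard T)) + size (circuit_nats (t_action T)) + 2.
  have H (g al : seq nat) (x y : nat) : size (x :: y :: g ++ al) = size g + size al + 2.
    by rewrite /= size_cat addn2.
  exact: H.
have rdone k : k <= 20 -> ~ (t_src T = q /\ guard_sat (t_guard T) xi) -> R (t4 + k) s4.
  move=> k20 no; exists G; split=> //.
  - rewrite p4' sz; split; last by lia.
    by rewrite /trans_time; lia.
  - exact: extends0.
  by move=> h1 h2; case: no.
apply: wp_if => /=; rewrite e4; case gs: guard_sat => // _; last first.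
  by st; rewrite -addnS; apply: rdone => // -[_]; rewrite gs.
apply: wp_if => /=; rewrite (f4 27) // (f4 29) // u1 (f1 29) // hq => nq.
  by st; rewrite -addnA -addnS; apply: rdone => // -[e' _]; move: nq; rewrite e'; lia.
have qe : t_src T = q by apply: ord_inj; lia.
have [ej eb _ _ _] := rep_ent r4 ie.
do 8 st; set s5 := update _ _ _ _; rewrite /= in s5 *.
have f5 y : y \notin [:: flag; tonh; pj; pb] -> s5 y = s4 y by move=> y'; rewrite /s5; others y y'.
set v := cap (fun x => block_val (circuit_eval (t_action T) (assignment_bits xi)) x + false * zeta x (t_dst T)).
have av : act (t_action T) xi = v by apply: cap_ext => x; rewrite addn0.
have sc : succ (nod G e) [::] (t_dst T, v).
  by rewrite ne -qe -av; constructor; rewrite ?qe.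
have ev : evalid w n (size (wrd G e)) [::] by split; rewrite ?take0 ?addn0 //; case: ve.
apply: (wp_emit (G := G) (e := e) (l := [::]) (q' := t_dst T) (b := false) (fl := false)
  (ob := circuit_eval (t_action T) (assignment_bits xi)) (D := D)) => //.
- by apply: static_frame st4 => y yy; rewrite f5 //; apply/negbT/(range_off _ yy).
- by apply: rep_frame r4 => y yy; rewrite f5 //; apply/negbT/(range_off _ yy).
- by rewrite size_map size_tuple.
- by rewrite f5 // f4 // f1.
- by rewrite /s5; memr; rewrite (f4 20) // (f1 20) // hc ej addn0.
- by rewrite /s5; memr; rewrite (f4 20) // (f1 20) // hc eb addn0.
- by rewrite f5 // f4 // q1.
move=> t6 s6 fr6 t6le r6.
have eb0 : ecost w a (size (wrd G e)) [::] = 0 by [].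
exists (push G e [::] (t_dst T, v) false); split=> //.
- rewrite fr6 // f5 // p4' sz; split; last by lia.
  have : nbits A <= size (circuit_nats (t_action T)).
    by rewrite /circuit_nats /= size_cat size_tuple; apply/leqW/leq_addl.
  by rewrite /trans_time; lia.
- by apply: (inv_push I ie ce sc ev (b := false)).
- by apply: extends_push I ie.
move=> _ _; have := covered_push_new G e [::] (t_dst T, v) false.
by rewrite /= addn0 addn0 av.
Qed.

Lemma wp_tick (G : search A) D e q xi (Q : nat -> memory -> Prop) t s :
  static w a n s -> rep s G -> search_inv w a n G D -> isid G e ->
  nod G e = (q, xi) -> q <> accept A -> cost w a (wrd G e) = lev G ->
  valid w n (wrd G e) ->
  s cur 0 = e -> s cq 0 = q -> at_ (s bits) 0 (map nat_of_bool (assignment_bits xi)) ->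
  (forall t' s' G', framed tick s s' -> t' <= t + 600 * (nX A + nbits A + 1) ->
     rep s' G' -> search_inv w a n G' D -> extends G G' e 1 ->
     (evalid w n (size (wrd G e)) [:: lambda q] ->
        covered G' (size (wrd G e)).+1 (q, elapse q 1 xi)
          (lev G + ecost w a (size (wrd G e)) [:: lambda q])) ->
     Q t' s') ->
  wp tick Q t s.
Proof.
move=> st0 r0 I ie ne qa ce ve hc hq hb h.
set j := size (wrd G e) in h *.
pose R t' s' := exists G', [/\ t' <= t + 600 * (nX A + nbits A + 1),
     rep s' G', search_inv w a n G' D, extends G G' e 1 &
     (evalid w n j [:: lambda q] -> covered G' j.+1 (q, elapse q 1 xi)
          (lev G + ecost w a j [:: lambda q]))].
suff wR : wp tick R t s.
  by apply: wp_mono wR _ => t' s' fr [G' [k2 k3 k4 k5 k6]]; apply: (h t' s' G').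
have [ej eb _ _ _] := rep_ent r0 ie; rewrite -/j in ej eb.
have rdone k s' : (forall y, y \notin [:: tonh; ok] -> s' y = s y) -> k <= t + 60 ->
    ~ evalid w n j [:: lambda q] -> R k s'.
  move=> f kt nev; exists G; split=> //; first by lia.
  - by apply: rep_frame r0 => y yy; rewrite f //; apply/negbT/(range_off _ yy).
  exact: extends0.
apply: wp_if => /=; rewrite hc ej (st_len st0) => jN; last first.
  by st; apply: rdone => //; [lia | case=> /=; lia].
have lq := num_lambda (st_num st0) q.
have w0 : s wd 0 = a by exact: (st_wd st0 (i := 0)).
have wj (jw : j < size w) : s wd (2 + j) = nth a w j.
  have := st_wd st0 (i := j.+2); rewrite /= size_map => /(_ jw).
  by rewrite (nth_map a).
(* [ok] is the test [evalid], [tonh] the cost of the step. *)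
pose bt := ecost w a j [:: lambda q] != 0.
have bE : ecost w a j [:: lambda q] = bt.
  by rewrite /bt /ecost; case: (size w - j) => [|k] //=; case: eqP.
pose vok := (j < size w) ==> (lambda q == nth a w j).
have vE : vok <-> evalid w n j [:: lambda q].
  rewrite /vok /evalid /= addn1; split.
    case: ltnP => /= jw.
      move/eqP => ->; split; first by lia.
      by rewrite (drop_nth a) //= take0; case E: (size w - j) => [|k] //=; lia.
    by move=> _; split; [lia | rewrite drop_oversize // (eqP (_ : size w - j == 0)) //; lia].
  case=> _; case: ltnP => //= jw; rewrite (drop_nth a) //= take0.
  by case E: (size w - j) => [|k] /=; [lia | case=> ->].
set t0 := t + _.
apply: wp_seq.
have w1 : wp (If (Minus $lenw (aJ @ $cur))
       (tonh ::= Const 0 ;;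
        ok ::= Minus (Const 1)
          (neq (num @ (Add (Const 6) $cq)) (wd @ (Add (Const 2) (aJ @ $cur)))))
       (tonh ::= Minus (Const 1)
          (Minus (Const 1) (neq (num @ (Add (Const 6) $cq)) (wd @ (Const 0)))) ;;
        ok ::= Const 1))
   (fun t' s' => [/\ t' <= t + 50, (forall y, y \notin [:: tonh; ok] -> s' y = s y),
      (s' ok 0 != 0) = vok & vok -> s' tonh 0 = bt]) t0.+1 s.
  have sub1 (x y : 'I_(nS A)) : (1 - (x - y + (y - x)) != 0) = (x == y).
    by apply/idP/idP => [|/eqP ->]; [move=> H; apply/eqP/ord_inj; lia | lia].
  apply: wp_if => /=; rewrite hc ej (st_lenw st0) => jw; do 3 st; split.
  1,5: by rewrite /t0 /=; lia.
  1,4: by move=> y y'; others y y'.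
  - have {}jw : j < size w by lia.
    by memr; rewrite hc ej hq lq wj // sub1 /vok jw.
  - have {}jw : j < size w by lia.
    rewrite /vok /bt /ecost jw /= => _; memr; case E: (size w - j) => [|k] //; lia.
  - have {}jw : (j < size w) = false by lia.
    by memr; rewrite /vok jw.
  have {}jw : size w - j = 0 by lia.
  move=> _; memr; rewrite hq lq w0 /bt /ecost jw /= addn0.
  have := sub1 (lambda q) a; case: (lambda q == a) => /= H; lia.
apply: wp_mono w1 _ => t1 s1 _ [t1le f1 o1 tn1].
apply: wp_if => /= o1'; last first.
  st; apply: rdone => //; first by lia.
  by rewrite -vE -o1 o1'.
have vk : vok by rewrite -o1.
have ev : evalid w n j [:: lambda q] by apply/vE.
set ab := assignment_bits xi in hb; have sab : size ab = nbits A := size_assignment_bits xi.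
pose J i t' s' := [/\ i <= nbits A /\ s' ui 0 = i, at_ (s' obits) 0 (map nat_of_bool (take i ab)),
  t' <= t1 + 20 + 30 * i & forall y, y \notin [:: ui; obits] -> s' y = s1 y].
have m0 := st_mm st0.
apply: wp_seq; apply: (@wp_for (nbits A) J _ _ _ _ _ _ (t1 + 20 + 30 * nbits A)).
- rewrite /J; fin; first by rewrite take0.
  by move=> y y'; others y y'.
- by move=> i t' s' [[i1 i2] i3 i4 i5]; fin; rewrite i5 // f1.
- move=> i t' s' iN [[i1 i2] i3 i4 i5]; st; rewrite /J; fin.
  + rewrite i2 (i5 21) // (f1 21) // (at_bool hb) ?sab // (take_nth false) ?sab // map_rcons.
    have := @at_setf _ _ _ (nat_of_bool (nth false ab i)) i3.
    by rewrite size_map size_takel ?sab.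
  by move=> y y'; others y y'; apply: i5.
move=> t2 s2 [[_ _] o2 t2le f2]; rewrite take_oversize ?sab // in o2.
have g2 y : y \notin [:: tonh; ok; ui; obits] -> s2 y = s y.
  by move=> y'; rewrite f2 ?f1 //; apply: contraNN y'; rewrite !inE => /orP[] ->; rewrite ?orbT.
do 8 st; set s3 := update _ _ _ _; rewrite /= in s3 *.
have f3 y : y \notin [:: flag; qq; pj; pb] -> s3 y = s2 y by move=> y'; rewrite /s3; others y y'.
have [n0 _ _ _ _] := num_head (st_num st0).
have sc : succ (nod G e) [:: lambda q] (q, elapse q 1 xi) by rewrite ne; constructor.
apply: (wp_emit (G := G) (e := e) (l := [:: lambda q]) (q' := q) (b := bt) (fl := true)
  (ob := ab) (D := D)) => //.
- by apply: static_frame st0 => y yy; rewrite f3 ?g2 //; apply/negbT/(range_off _ yy).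
- by apply: rep_frame r0 => y yy; rewrite f3 ?g2 //; apply/negbT/(range_off _ yy).
- by rewrite f3 // g2.
- by rewrite /s3; memr; rewrite (g2 50) // (g2 20) // hc ej.
- by rewrite /s3; memr; rewrite (g2 51) // (g2 20) // (g2 2) // hc eb n0; lia.
- by rewrite /s3; memr; rewrite (g2 29).
- by rewrite f3 // f2 // tn1.
rewrite (_ : cap _ = elapse q 1 xi); last first.
  by apply: cap_ext => x; rewrite block_val_bits mul1n; case: zeta; rewrite ?addn0.
move=> t6 s6 fr6 t6le r6.
exists (push G e [:: lambda q] (q, elapse q 1 xi) bt); split=> //.
- by rewrite /t0 /= in t1le; lia.
- by apply: (inv_push I ie ce sc ev).
- by apply: extends_push I ie.
move=> _; have := covered_push_new G e [:: lambda q] (q, elapse q 1 xi) bt.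
by rewrite addn1 bE.
Qed.

End Expand.

Lemma succ_inv (A : automaton) (c : node A) l c' : succ c l c' ->
  (exists d : 'I_(nD A), [/\ t_src (Delta d) = c.1, guard_sat (t_guard (Delta d)) c.2, l = [::] &
     c' = (t_dst (Delta d), act (t_action (Delta d)) c.2)]) \/
  (l = [:: lambda c.1] /\ c' = (c.1, elapse c.1 1 c.2)).
Proof. by case=> [d xi sa g|q xi qa]; [left; exists d | right]. Qed.

Lemma succ_live (A : automaton) (c : node A) l c' : succ c l c' -> c.1 <> accept A.
Proof. by case. Qed.

Section ExpandNode.

Variables (A : automaton) (w : seq 'I_(nS A)) (a : 'I_(nS A)) (n : nat).

(** The first summand pays for the pass over the code, the second for the rounds of [pack] over the
    stopwatches, once per transition. *)
Definition expand_time := 2000 * (automaton_size A + nD A * nX A).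

Lemma wp_expand (G : search A) D e q xi (Q : nat -> memory -> Prop) t s :
  static w a n s -> rep s G -> search_inv w a n G D -> isid G e ->
  nod G e = (q, xi) -> q <> accept A -> cost w a (wrd G e) = lev G ->
  valid w n (wrd G e) -> s cur 0 = e ->
  (forall t' s' G', framed expand s s' -> t' <= t + expand_time ->
     rep s' G' -> search_inv w a n G' D -> extends G G' e (nD A).+1 ->
     closed_at w a n G' (cfg G e, lev G) ->
     Q t' s') ->
  wp expand Q t s.
Proof.
move=> st0 r0 I ie ne qa ce ve hc h.
pose R t' s' := exists G', [/\ t' <= t + expand_time,
     rep s' G', search_inv w a n G' D, extends G G' e (nD A).+1 &
     closed_at w a n G' (cfg G e, lev G)].
suff wR : wp expand R t s.
  by apply: wp_mono wR _ => t' s' fr [G' [k2 k3 k4 k5 k6]]; apply: (h t' s' G').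
have [_ _ eq ec _] := rep_ent r0 ie; rewrite ne /= in eq ec.
have [_ _ n3 _ _] := num_head (st_num st0).
do 4 st; set s1 := update _ _ _ _; rewrite /= in s1 *.
have f1 y : y \notin [:: cq; cc] -> s1 y = s y by move=> y'; rewrite /s1; others y y'.
have st1 : static w a n s1.
  by apply: static_frame st0 => y yy; rewrite f1 //; apply/negbT/(range_off _ yy).
have c1 : s1 cc 0 = bin_val (assignment_bits xi) by rewrite /s1; memr; rewrite hc ec.
have q1 : s1 cq 0 = q by rewrite /s1; memr; rewrite hc eq.
st; apply: (wp_unpack (l := assignment_bits xi) st1) => //; first exact: size_assignment_bits.
move=> t2 s2 fr2 t2le b2; do 2 st; set s3 := update _ _ _ _; rewrite /= in s3 *.
have f3 y : y \notin ptr :: mods unpack -> s3 y = s1 y.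
  move=> y'; rewrite /s3; others y y'; apply: fr2.
  by move: y'; rewrite in_cons negb_or => /andP[_ /negbTE].
have b3 : at_ (s3 bits) 0 (map nat_of_bool (assignment_bits xi)) by rewrite /s3; mem.
pose tr := [seq transition_nats (Delta d) | d <- enum 'I_(nD A)].
have str : size tr = nD A by rewrite size_map size_enum_ord.
pose bT := 6 + nQ A + nX A + nX A * nQ A.
have atr : at_ (s num) bT (flatten tr) := num_trans (st_num st0).
pose S k := size (flatten (take k tr)).
have Sle k : S k <= S (nD A).
  rewrite /S [take (nD A) tr]take_oversize ?str // -{2}(cat_take_drop k tr) flatten_cat size_cat.
  exact: leq_addr.
have SS (d : 'I_(nD A)) : S d.+1 = S d + size (transition_nats (Delta d)).
  rewrite /S (take_nth [::]) ?str // flatten_rcons size_cat.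
  by rewrite (nth_map d) ?size_enum_ord // nth_ord_enum.
have trd (d : 'I_(nD A)) : at_ (s num) (bT + S d) (transition_nats (Delta d)).
  move: atr; rewrite -{1}(cat_take_drop d tr) flatten_cat at_cat => -[_].
  by rewrite (drop_nth [::]) ?str //= at_cat (nth_map d) ?size_enum_ord // nth_ord_enum; case.
(* The successors by the first [k] transitions are covered; [extends] carries this over the later
   pushes. *)
pose J k t' s' := exists Gk, [/\ k <= nD A /\ s' itr 0 = k,
  (forall y, y \notin itr :: mods trans_step -> s' y = s3 y) /\ s' ptr 0 = bT + S k,
  t' <= t2 + 20 + 700 * (S k + k * nX A + k),
  [/\ rep s' Gk, search_inv w a n Gk D & extends G Gk e k] &
  forall d : 'I_(nD A), d < k -> t_src (Delta d) = q -> guard_sat (t_guard (Delta d)) xi ->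
    covered Gk (size (wrd G e)) (t_dst (Delta d), act (t_action (Delta d)) xi) (lev G)].
st; apply: (@wp_for (nD A) J _ _ _ _ _ _ (t2 + 20 + 700 * (S (nD A) + nD A * nX A + nD A))).
- exists G; fin.
  + by move=> y y'; rewrite update_other //; move: y'; rewrite in_cons negb_or => /andP[/negbTE].
  + by rewrite /s3; memr; rewrite (fr2 10) // (f1 10) // (st_bTrans st0) /S take0 addn0.
  + apply: rep_frame r0 => y yy; rewrite update_other; last by apply/negbTE/negP => /eqP e'; rewrite e' in yy.
    by rewrite f3 ?f1 //; apply/negbT/(range_off _ yy).
  exact: extends0.
- move=> k t' s' [Gk [[k1 k2] [k3 k4] k5 _ _]]; fin; last by have := Sle k; nia.
  by rewrite k3 // f3 // f1.
{ move=> k t' s' kD [Gk [[k1 k2] [k3 k4] k5 [k6 k7 k8] k9]].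
  pose d := Ordinal kD; have [[ik ek] vk lk _ mk] := k8.
  have wk : wrd Gk e = wrd G e by rewrite /wrd ek.
  have g y : y \notin itr :: mods trans_step -> y \notin ptr :: mods unpack -> y \notin [:: cq; cc] -> s' y = s y.
    by move=> h1 h2 h3; rewrite k3 // f3 // f1.
  apply: (wp_trans_step (d := d) (G := Gk) (D := D) (e := e) (q := q) (xi := xi) (a := a) (w := w) (n := n)) => //.
  - apply: static_frame st0 => y yy; apply: g; apply/negbT/(range_off _ yy) => //.
  - by rewrite /nod ek.
  - by rewrite wk lk.
  - by rewrite wk.
  - by rewrite g.
  - by rewrite k3 // f3.
  - by rewrite k3.
  - by rewrite g // k4; apply: trd.
  rewrite lk wk => t4 s4 G4 fr4 t4le p4 r4 i4 x4 c4.
  exists G4; fin.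
  + by rewrite (fr4 26) // k2.
  + move=> y y'; others y y'; rewrite fr4 ?k3 //.
    by move: y'; rewrite in_cons negb_or => /andP[_ /negbTE].
  + by rewrite p4 k4 (SS d) addnA.
  + by rewrite (SS d) /trans_time /= in t4le *; lia.
  + apply: rep_frame r4 => y yy; rewrite update_other //; apply/negbTE/negP => /eqP e'; rewrite e' in yy.
    by [].
  + by rewrite -addn1; apply: extends_trans k8 x4.
  move=> d' dk; case: (eqVneq d' d) => [-> //|nd].
  have dk' : d' < k.
    by rewrite ltnS leq_eqVlt in dk; case/orP: dk => // /eqP e'; case/eqP: nd; apply: ord_inj.
  by move=> h1 h2; case: x4 => _ _ _ _; apply; apply: k9. }
move=> t4 s4 [G4 [[_ _] [k3 k4] k5 [k6 k7 k8] k9]].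
have [[ik ek] vk lk _ mk] := k8.
have wk : wrd G4 e = wrd G e by rewrite /wrd ek.
have g y : y \notin itr :: mods trans_step -> y \notin ptr :: mods unpack -> y \notin [:: cq; cc] -> s4 y = s y.
  by move=> h1 h2 h3; rewrite k3 // f3 // f1.
apply: (wp_tick (G := G4) (D := D) (e := e) (q := q) (xi := xi) (a := a) (w := w) (n := n)) => //.
- apply: static_frame st0 => y yy; apply: g; apply/negbT/(range_off _ yy) => //.
- by rewrite /nod ek.
- by rewrite wk lk.
- by rewrite wk.
- by rewrite g.
- by rewrite k3 // f3.
- by rewrite k3.
rewrite lk wk => t5 s5 G5 fr5 t5le r5 i5 x5 c5.
have x05 : extends G G5 e (nD A).+1 by rewrite -addn1; apply: extends_trans k8 x5.
exists G5; split=> //.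
- have := automaton_size_ge A; rewrite nats_size -/tr.
  have -> : flatten tr = flatten (take (nD A) tr) by rewrite take_oversize ?str.
  have : nD A <= S (nD A).
    have : all (fun l => 0 < size l) tr by apply/allP => _ /mapP[d _ ->].
    rewrite /S take_oversize ?str // -{1}str.
    by elim: (tr) => //= l r IH /andP[l0 /IH]; rewrite size_cat; lia.
  by rewrite -/(S (nD A)) /expand_time /= in t5le *; lia.
move=> l c'; rewrite /cfg /= ne => /succ_inv[[d [/= d1 d2 -> ->]]|[-> ->]] ev /=.
  by rewrite addn0 addn0; case: x5 => _ _ _ _; apply; apply: k9.
by rewrite addn1; apply: c5.
Qed.

End ExpandNode.

(** * The search loop *)

(** The table is marked before acceptance is tested, so an accepting configuration below the last
    layer is visited but not expanded. Clearing both stacks ends the loop once an optimal entry is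
    in [found]. *)
Definition main_step : prog :=
  If $hc Skip (hc ::= $hn ;; hn ::= Const 0) ;;
  cur ::= $hc ;; hc ::= aL @ $cur ;;
  If (aV @ (aG @ $cur)) Skip
    (Store aV (aG @ $cur) (Const 1) ;;
     If (neq (aQ @ $cur) (num @ (Const 5)))
       expand
       (If (neq (aJ @ $cur) $len) Skip
          (found ::= $cur ;; hc ::= Const 0 ;; hn ::= Const 0))).

Definition main_loop : prog := While (Add $hc $hn) main_step.

Lemma card_assignment A : #|{: assignment A}| = bound A.
Proof.
rewrite /bound card_dep_ffun foldrE big_map big_enum /=.
by apply: eq_bigr => x _; rewrite card_ord.
Qed.

(** The table reserves [2 ^ nbits A] cells per layer and state, but the visited configurations are
    distinct and carry genuine assignments, so at most [bound A] of these cells are ever set. *)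
Lemma vis_bound A (w : seq 'I_(nS A)) a n G D : search_inv w a n G D ->
  size (vis G) <= (size w + n).+1 * (nQ A * bound A).
Proof.
move=> I; set N := size w + n.
pose f (jc : nat * node A) : 'I_N.+1 * node A := (inord jc.1, jc.2).
have u : uniq (map f (map fst (vis G))).
  rewrite map_inj_in_uniq; first exact: (inv_uniq I).
  move=> [j c] [j' c'] /mapP[v vv /= e] /mapP[v' vv' /= e'] /(congr1 (fun x => (val x.1, x.2))) /=.
  have [_ jN _] := inv_vis I vv; have [_ jN' _] := inv_vis I vv'.
  by rewrite -e -e' /= in jN jN'; rewrite !inordK.
rewrite -(size_map fst) -(size_map f); move/card_uniqP: u => <-.
apply: leq_trans (max_card _) _.
by rewrite !card_prod !card_ord card_assignment.
Qed.

Section Loop.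

Variables (A : automaton) (w : seq 'I_(nS A)) (a : 'I_(nS A)) (n : nat).

Let N := size w + n.

Lemma inv_cons G D v : search_inv w a n G D -> closed_at w a n G v ->
  search_inv w a n G (v :: D).
Proof.
move=> [h1 h2 h3 h4 h5 h6 h7 h8 h9] cv; split=> // v'.
by rewrite inE => /orP[/eqP ->|/h9].
Qed.

Definition pending (G : search A) := size (ch G) + size (nh G).

(* The bound on the clock charges 200 units to every popped entry and
   [expand_time A + 200] to every visited configuration. *)
Definition spent t0 t (G : search A) : Prop :=
  t + 200 * pending G <= t0 + 200 * size (ents G) + (expand_time A + 200) * size (vis G) /\
  size (ents G) <= 1 + (nD A).+1 * size (vis G).

(** The array [out] is zero throughout the search, which already encodes rejection. *)
Definition running t0 t s : Prop := exists G,
  [/\ static w a n s, rep s G, search_inv w a n G (vis G), spent t0 t G & s found 0 = 0 /\ s out = (fun=> 0)].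

Definition max_vis := N.+1 * (nQ A * bound A).

(** The bound in [spent] with the number of entries replaced by its own bound; of the 400, the root
    entry takes 200 and the rest is slack. *)
Definition loop_time := 400 + 200 * ((nD A).+1 * max_vis) + (expand_time A + 200) * max_vis.

(** [search_inv] fails at this point, as an accepting configuration of the last layer has been
    marked. What is kept are optimality and the parent structure. *)
Definition finished t0 t s : Prop := exists G e,
  [/\ static w a n s, rep s G, s hc 0 = 0 /\ s hn 0 = 0, isid G e /\ s found 0 = e &
  [/\ t <= t0 + loop_time, size (ents G) <= 1 + (nD A).+1 * max_vis,
      best_extension w a n (drop (size w) (wrd G e)), size (wrd G e) = N &
      s out = (fun=> 0) /\ forall e, isid G e -> par G e = 0 /\ wrd G e = [::] \/
        0 < par G e < e /\ exists2 l, succ (nod G (par G e)) l (nod G e) & wrd G e = wrd G (par G e) ++ l]].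

Lemma linked_head f h (G : search A) l : linked f h l -> (forall i, i \in l -> isid G i) ->
  (h == 0) = (l == [::]).
Proof.
case: l => [/= -> //|e l /= [-> _] /(_ e)]; rewrite inE eqxx => /(_ isT) /andP[].
by rewrite lt0n => /negbTE ->.
Qed.

Lemma spent_bound t0 t G D : search_inv w a n G D -> spent t0 t G ->
  t + 200 * pending G + 200 <= t0 + loop_time /\ size (ents G) <= 1 + (nD A).+1 * max_vis.
Proof.
move=> I [s1 s2]; have := vis_bound I; rewrite -/N -/max_vis => vb.
have h1 : (nD A).+1 * size (vis G) <= (nD A).+1 * max_vis by rewrite leq_mul2l vb orbT.
have h2 : (expand_time A + 200) * size (vis G) <= (expand_time A + 200) * max_vis.
  by rewrite leq_mul2l vb orbT.
by rewrite /loop_time; split; lia.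
Qed.

Lemma wp_main_step t0 t s : running t0 t s -> s hc 0 + s hn 0 != 0 ->
  wp main_step (fun t' s' => running t0 t' s' \/ finished t0 t' s') (t + 6) s.
Proof.
move=> [G [st0 r0 I sp [sf so]]] hnz; apply: wp_seq.
have idc i : i \in ch G -> isid G i by move=> ii; apply: (inv_ids I); rewrite ii.
have idn i : i \in nh G -> isid G i by move=> ii; apply: (inv_ids I); rewrite ii orbT.
have w1 : wp (If $hc Skip (hc ::= $hn ;; hn ::= Const 0))
    (fun t1 s1 => exists G1, [/\ rep s1 G1, search_inv w a n G1 (vis G1), ch G1 <> [::],
      spent t0 t G1 /\ t1 <= t + 40 & forall y, y \notin [:: hc; hn] -> s1 y = s y]) (t + 6).+1 s.
  apply: wp_if => /= h0.
    st; exists G; split=> //; last by split=> //; lia.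
    by move/eqP; rewrite -(linked_head (rep_ch r0) idc) (negbTE h0).
  have c0 : ch G = [::] by apply/eqP; rewrite -(linked_head (rep_ch r0) idc) h0.
  have [r1 r2 r3 r4 r5] := r0.
  do 3 st; exists (swap G); split.
  - by split=> //; mem.
  - exact: inv_swap c0 I.
  - by move/eqP; rewrite /= -(linked_head r4 idn); move: hnz; rewrite h0 => /negbTE ->.
  - move: sp; rewrite /spent /pending /= c0 /=; split; lia.
  by move=> y y'; others y y'.
apply: wp_mono w1 _ => t1 s1 _ [G1 [{}r0 {}I cn [{}sp t1le] f1]].
case ce: (ch G1) cn => [//|e r] _.
have ie : isid G1 e by apply: (inv_ids I); rewrite ce inE eqxx.
have ho : ohead (ch G1) = Some e by rewrite ce.
have [r1 r2 r3 r4 r5] := r0; have [ej eb eq ec [eg ep]] := r2 _ ie.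
rewrite ce in r3; case: r3 => hce lr.
do 4 st; set s2 := update _ _ _ _; rewrite /= hce in s2 *.
have f2 y : y \notin [:: cur; hc; hn] -> s2 y = s y.
  move=> y'; rewrite /s2; others y y'; apply: f1.
  by move: y'; rewrite in_cons negb_or => /andP[].
have ra : rep s2 (pop G1) by split; rewrite /s2; mem; rewrite //= ce.
have st2 : static w a n s2.
  by apply: static_frame st0 => y yy; rewrite f2 //; apply/negbT/(range_off _ yy).
have c2 : s2 cur 0 = e by rewrite /s2; memr.
have pe : pending (pop G1) = (pending G1).-1 by rewrite /pending /= ce.
have pg : 0 < pending G1 by rewrite /pending ce.
have [va rw] := inv_ent I ie.
have ceq : cost w a (wrd G1 e) = lev G1 by apply: (inv_ch I); rewrite ce inE eqxx.
have q2 y : 50 <= y <= 56 -> s2 y = s1 y.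
  move=> yy; have y' : y \notin [:: cur; hc; hn] by apply/negbT/(range_off _ yy).
  by rewrite /s2; others y y'.
have v2 : s2 aV = s1 aV by rewrite /s2; mem.
apply: wp_if => /=; rewrite c2 (q2 54) // v2 eg r5 => hv.
  st; left; exists (pop G1); split=> //.
  - apply: (inv_pop ho _ I); move: hv; rewrite /cfg.
    by case: (_ \in _).
  - by move: sp; rewrite /spent pe /=; lia.
  by rewrite !f2.
have nv : cfg G1 e \notin map fst (vis G1) by move: hv; rewrite /cfg; case: (_ \in _).
do 2 st; set s3 := update _ _ _ _; rewrite /= c2 (q2 54) // eg in s3 *.
have f3 y : y \notin [:: aV] -> s3 y = s2 y by move=> y'; rewrite /s3; others y y'.
have r3v : rep s3 (visit G1 e).
  case: ra => k1 k2 k3 k4 k5; split; rewrite ?(f3 56) ?(f3 58) ?(f3 59) ?(f3 60) //.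
  move=> j c; rewrite /s3; mem; rewrite /= inE /setf; case: (eqVneq (j, c) _) => [[-> ->]|nj].
    by rewrite /cfg eqxx.
  by rewrite ifN ?k5 //; apply: contraNN nj => /eqP /idx_inj [-> ->].
have st3 : static w a n s3.
  by apply: static_frame st2 => y yy; rewrite f3 //; apply/negbT/(range_off _ yy).
have [_ _ _ _ n5] := num_head (st_num st3).
have pv : pending (visit G1 e) = (pending G1).-1 by rewrite /pending /= ce.
(* The popped entry and the new element of [vis] release enough units for this round, and the new
   entries balance the new pending ones. *)
have spv t' G' : extends (visit G1 e) G' e (nD A).+1 -> t' <= t1 + 100 + expand_time A -> spent t0 t' G'.
  move=> [_ vk _ [h1 h2] _] tk; move: sp h1 h2; rewrite /spent -/(pending G') -/(pending (visit G1 e)) pv vk /=.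
  by move=> [s1' s2'] h1 h2; split; lia.
have fo : s3 found 0 = 0 /\ s3 out = (fun=> 0) by rewrite !f3 ?f2.
apply: wp_if => /=; rewrite (f3 20) // c2 (f3 52) // (q2 52) // eq n5 => hq.
  have qa : (nod G1 e).1 <> accept A by move=> q; rewrite q in hq; move: hq; lia.
  have Iv : search_inv w a n (visit G1 e) (vis G1) by apply: inv_visit ho nv _ I; case.
  apply: (wp_expand (G := visit G1 e) (D := vis G1) (e := e) (q := (nod G1 e).1) (xi := (nod G1 e).2) st3) => //.
  - exact: surjective_pairing.
  move=> t4 s4 G4 fr4 t4le r4' I4 x4 c4; left; exists G4.
  have [_ vk lk _ _] := x4; split=> //.
  - by apply: static_frame st3 => y yy; rewrite fr4 //; apply/(range_off _ yy).
  - by rewrite vk; apply: inv_cons I4 _; rewrite -lk in c4 *; rewrite /= lk in c4 *; exact: c4.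
  - by apply: spv x4 _; lia.
  by rewrite (fr4 61) // (fr4 1).
have qa : (nod G1 e).1 = accept A by apply: ord_inj; lia.
apply: wp_if => /=; rewrite (f3 20) // c2 (f3 50) // (q2 50) // ej (st_len st3) => hj.
  have nN : size (wrd G1 e) <> N by rewrite /N; lia.
  have Iv : search_inv w a n (visit G1 e) (vis G1) by apply: inv_visit ho nv _ I; case.
  st; left; exists (visit G1 e); split=> //.
  - apply: inv_cons Iv _ => l c' /succ_live /= na.
    by case: na.
  by apply: spv (@extends0 _ (visit G1 e) e _ ie) _; lia.
have jN : size (wrd G1 e) = N by rewrite /N; lia.
have [sb1 sb2] := spent_bound I sp.
do 5 st; right; exists (Search (ents G1) [::] [::] (vis (visit G1 e)) (lev G1)), e; split=> //.
- by apply: static_frame st3 => y yy; rewrite !update_other //; apply/negbTE/negP => /eqP e'; rewrite e' in yy.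
- by case: r3v => k1 k2 k3 k4 k5; split; mem.
split=> //; first by lia.
- exact: best_entry I ie ceq jN qa.
by split; [mem; case: fo | exact: (inv_par I)].
Qed.

Lemma wp_main_loop t0 s (Q : nat -> memory -> Prop) :
  running t0 t0 s ->
  (forall t' s', t' <= t0 + loop_time + 20 ->
     (static w a n s' /\ s' found 0 = 0 /\ s' out = (fun=> 0) /\ ~ (exists v, extension w n v)) \/
     finished t0 (t' - 6) s' -> Q t' s') ->
  wp main_loop Q t0 s.
Proof.
move=> r0 h.
apply: (@wp_while (t0 + loop_time) (fun t s => running t0 t s \/ finished t0 t s)).
- by left.
- move=> t s' [[G [_ _ I sp _]]|[G [e [_ _ _ _ []]]]] //.
  by have [] := spent_bound I sp; lia.
- move=> t s' [r|[G [e [_ _ [h1 h2] _ _]]]] /= nz; last by rewrite h1 h2 in nz.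
  exact: wp_main_step r nz.
move=> t s' [[G [st0 r I sp [sf so]]]|f] /= z; apply: h.
- by have [] := spent_bound I sp; lia.
- left; split=> //; split=> //; split=> //.
  have idc i : i \in ch G -> isid G i by move=> ii; apply: (inv_ids I); rewrite ii.
  have idn i : i \in nh G -> isid G i by move=> ii; apply: (inv_ids I); rewrite ii orbT.
  apply: (no_extension I); apply/eqP.
    by rewrite -(linked_head (rep_ch r) idc); lia.
  by rewrite -(linked_head (rep_nh r) idn); lia.
- by case: f => G [e [_ _ _ _ []]]; lia.
(* The clock of [finished] is read before the last loop test, which costs 6. *)
by right; rewrite addnK.
Qed.

End Loop.

(** * Writing the answer *)

(** Every parent edge writes a letter, even a jump. What a jump writes is overwritten when the
    backward walk reaches the tick that read the letter at this position. By truncated subtraction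
    everything up to the end of [w] goes to cell 0, which receives its final value at the end. *)
Definition walk : prog :=
  If $found
    (cur ::= $found ;;
     While (aP @ $cur)
       (src ::= aP @ $cur ;;
        Store out (Minus (aJ @ $cur) $lenw) (num @ (Add (Const 6) (aQ @ $src))) ;;
        cur ::= $src) ;;
     Store out (Const 0) (Const 1))
    Skip.

Lemma wp_walk A (w : seq 'I_(nS A)) a n t0 t t1 s (Q : nat -> memory -> Prop) :
  finished w a n t0 t s -> t1 <= t + 10 ->
  (forall t' s', t' <= t0 + loop_time w n + 100 + 100 * ((nD A).+1 * max_vis w n) ->
     (exists v : seq 'I_(nS A), best_extension w a n v /\ outputs s' v) -> Q t' s') ->
  wp walk Q t1 s.
Proof.
move=> [G [e [st0 r0 _ [ie sf] [tt esz be sz [so pr]]]]] tt1 h.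
pose R t' s' := t' <= t0 + loop_time w n + 100 + 100 * ((nD A).+1 * max_vis w n) /\
  exists v : seq 'I_(nS A), best_extension w a n v /\ outputs s' v.
suff wR : wp walk R t1 s by apply: wp_mono wR _ => t' s' _ []; apply: h.
have /andP[e0 eG] := ie.
apply: wp_if => /=; rewrite sf; last by move=> e1; rewrite e1 in e0.
move=> _; do 3 st; rewrite sf.
set N := size w + n in sz.
(* Parents have smaller numbers, so [e'] bounds the remaining rounds. The cells for positions from
   [size (wrd G e')] on are final. *)
pose I t' s' := exists e', [/\ isid G e' /\ s' cur 0 = e',
  t' + 50 * e' <= t + 30 + 50 * e,
  forall y, y \notin [:: cur; src; out] -> s' y = s y,
  exists z, wrd G e = wrd G e' ++ z &
  forall i, size (wrd G e') <= i < N -> size w <= i ->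
    s' out (i.+1 - size w) = nth a (wrd G e) i].
apply: (@wp_while (t + 30 + 50 * e) I).
- exists e; split.
  + by split=> //; memr.
  + by lia.
  + by move=> y y'; others y y'.
  + by exists [::]; rewrite cats0.
  by move=> i; rewrite sz; lia.
- by move=> t' s' [e' [_ ? _ _ _]]; lia.
- move=> t' s' [e' [[i1 i2] i3 i4 [z i5] i6]] /=; rewrite i2 (i4 55) //.
  have [ej _ _ _ [_ ep]] := rep_ent r0 i1; rewrite ep => pn.
  case: (pr _ i1) => [[p0]|[/andP[p1 p2] [l sl wl]]]; first by rewrite p0 in pn.
  have ip : isid G (par G e') by move: i1; rewrite /isid; lia.
  have [_ _ eq _ _] := rep_ent r0 ip.
  have lam := num_lambda (st_num st0) (nod G (par G e')).1.
  do 5 st; exists (par G e'); split.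
  + by split=> //; memr; rewrite i2 (i4 55).
  + by move: i3; rewrite /=; lia.
  + by move=> y y'; others y y'; apply: i4.
  + by exists (l ++ z); rewrite i5 wl catA.
  move=> i ii wi; memr.
  rewrite i2 (i4 50) // (i4 55) // (i4 6) // (i4 52) // (i4 2) // ej ep eq lam (st_lenw st0).
  rewrite /setf; case: eqP => [ij|ij].
    case: sl wl => [d xi _ _|q xi _] wl; rewrite wl size_cat /= in ij *; first by lia.
    have -> : i = size (wrd G (par G e')) by lia.
    by rewrite i5 wl -catA nth_cat ltnn subnn.
  apply: i6 => //; rewrite wl size_cat; case: sl wl => [d xi _ _|q xi _] wl /=; first by lia.
  by move: ij; rewrite wl size_cat /=; lia.
move=> t' s' [e' [[i1 i2] i3 i4 _ i6]] /=; rewrite i2 (i4 55) //.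
have [_ _ _ _ [_ ep]] := rep_ent r0 i1; rewrite ep => p0.
case: (pr _ i1) => [[_ w0]|[]]; last by rewrite p0.
rewrite w0 /= in i6; st; split.
  have e1 : e <= 1 + (nD A).+1 * max_vis w n by lia.
  by rewrite /=; lia.
exists (drop (size w) (wrd G e)); split=> //; split; first by memr.
apply: (@eq_from_nth _ 0); rewrite !size_map size_iota // => i iv.
rewrite (nth_map 0) ?size_iota // nth_iota // (nth_map a) // nth_drop; memr.
move: iv; rewrite size_drop sz => iv; rewrite -i6; try lia.
by rewrite setf_neq //; congr (s' _ _); lia.
Qed.

(** * The program *)

(** [obits] is still zero, so [pack] yields the code of the zero assignment and, with the start
    state in [gg], the index of the initial configuration. The layer and the parent of entry 1 are 0
    and need no write. *)
Definition init_search : prog :=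
  flag ::= Const 0 ;; qq ::= num @ (Const 4) ;; gg ::= num @ (Const 4) ;;
  pack ;;
  nent ::= Const 1 ;;
  Store aQ (Const 1) (num @ (Const 4)) ;;
  Store aC (Const 1) $code ;;
  Store aG (Const 1) $gg ;;
  hc ::= Const 1.

Definition solver : prog :=
  parse_list num ;; parse_list wd ;; setup ;; init_search ;; main_loop ;; walk.

Lemma bin_val_nseq k : bin_val (nseq k false) = 0.
Proof. by elim: k => // k IH; rewrite /= bin_val_cons IH. Qed.

Lemma mem_off (l ys : seq nat) y :
  all (fun z => z \notin l) ys -> y \in ys -> (y \in l) = false.
Proof. by move=> /allP h /h /negbTE. Qed.

Lemma wp_init_search A (w : seq 'I_(nS A)) a n t s (Q : nat -> memory -> Prop) :
  static w a n s -> (forall y, y \in out :: 22 :: 35 :: iota 50 12 -> s y = (fun=> 0)) ->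
  (forall t' s', t' <= t + 150 + 200 * (nX A + nbits A) ->
     (forall u, running w a n u u s') -> Q t' s') ->
  wp init_search Q t s.
Proof.
move=> st0 z h; have [_ _ _ n4 _] := num_head (st_num st0).
do 6 st; set s1 := update _ _ _ _; rewrite /= in s1 *.
have f1 y : y \notin [:: flag; qq; gg] -> s1 y = s y by move=> y'; rewrite /s1; others y y'.
have st1 : static w a n s1.
  by apply: static_frame st0 => y yy; rewrite f1 //; apply/negbT/(range_off _ yy).
pose ob := nseq (nbits A) false.
st; apply: (wp_pack (q := start A) (fl := false) (ob := ob) (g0 := start A) st1).
- by rewrite size_nseq.
- by move=> i; rewrite size_map size_nseq => im; rewrite f1 // z // (nth_map false) ?size_nseq // nth_nseq im.
- by rewrite /s1; memr.
- by rewrite /s1; memr.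
- by rewrite /s1; memr.
move=> t2 s2 fr2 t2le; rewrite (_ : cap _ = (init_node A).2); last first.
  apply: cap_ext => x; rewrite addn0 /block_val nth_reshape drop_nseq.
  have -> k m : take k (nseq m false) = nseq (minn k m) false.
    by elim: k m => [|k IH] [|m] //=; rewrite IH minnSS.
  by rewrite bin_val_nseq.
move=> /= e1 e2; do 8 st; st; set s3 := update _ _ _ _; rewrite /= in s3 *.
have f3 y : y \notin [:: 52; 53; 54; 58; 60] -> s3 y = s2 y by move=> y'; rewrite /s3; others y y'.
have g y : y \in out :: iota 50 12 -> s2 y = (fun=> 0).
  move=> y'; rewrite fr2; last exact: mem_off y'.
  rewrite f1; last by apply/negbT/(mem_off _ y').
  have /allP sub : all [in out :: 22 :: 35 :: iota 50 12] (out :: iota 50 12) by [].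
  by apply: z; apply: sub.
have [n0 _ _ _ _] := num_head (st_num st0).
have s24 : s2 2 4 = start A by rewrite fr2 // f1.
apply: h => [|u]; first by lia.
exists (start_search A); split.
- apply: static_frame st1 => y yy; rewrite f3; last by apply/negbT/(range_off _ yy).
  by rewrite fr2 //; apply: range_off yy.
- split.
  + by rewrite /s3; memr.
  + case=> [|[|k]] // _; rewrite /s3; mem; rewrite !setf_eq ?(g 50) ?(g 51) ?(g 55) //.
    split; rewrite ?s24 ?e1 ?e2 //.
  + by rewrite /s3; mem; rewrite /= g.
  + by rewrite /s3; mem; rewrite /= g.
  by move=> j c; rewrite /s3; mem; rewrite g.
- exact: inv_start_search.
- by split; rewrite /pending /= ?muln0 //; lia.
by rewrite /s3; mem; rewrite !g.
Qed.

(** * The sizes of the input and the total time *)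

Lemma automaton_dims A :
  6 + nQ A + nX A + nX A * nQ A + nD A + 2 * (nbits A + width (nS A)) <= automaton_size A.
Proof.
apply: leq_trans (automaton_size_ge A); rewrite nats_size leq_add2r leq_add2l.
have {1}-> : nD A = size [seq transition_nats (Delta d) | d <- enum 'I_(nD A)].
  by rewrite size_map size_enum_ord.
have : all (fun l => 0 < size l) [seq transition_nats (Delta d) | d <- enum 'I_(nD A)].
  by apply/allP => _ /mapP[d _ ->].
by elim: [seq _ | _ <- _] => //= l r IH /andP[l0 /IH]; rewrite size_cat; lia.
Qed.

(** A letter is below [nS], whose width the code of [A] pays for, and the width of a number is at
    most the number; this handles [n] and the length of the list. *)
Lemma size_query A (w : seq 'I_(nS A)) (a : 'I_(nS A)) n :
  size (enc_nats (nat_of_ord a :: n :: map val w)) <=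
  20 * (automaton_size A * maxn 1 (size w + n)).
Proof.
have d := automaton_dims A; set L := automaton_size A in d *; set m := maxn _ _.
have wl (x : 'I_(nS A)) : width x <= L.
  by apply: leq_trans (width_mono (ltnW (ltn_ord x))) _; lia.
have sw : sumn (map width (map val w)) <= size w * L.
  by elim: (w) => //= x v IH; rewrite mulSn leq_add.
rewrite size_enc_nats /= size_map.
have := leq_width (size w).+2; have := leq_width n; have := wl a => h1 h2 h3.
have m1 : size w + n <= m by rewrite leq_maxr.
have m0 : 1 <= m by rewrite leq_maxl.
have L0 : 1 <= L by lia.
have p1 : size w * L <= L * m by rewrite mulnC leq_mul2l; lia.
have p2 : m <= L * m by rewrite leq_pmull.
have p3 : L <= L * m by rewrite leq_pmulr.
by rewrite /= in sw; lia.
Qed.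

(* The three products to bound are [nQ * L], [nQ * nX * nD] and [nQ * nD],
   each at most [L ^ 2]: the table of zeta makes [nX * nQ] at most [L]. *)
Lemma total_time A (w : seq 'I_(nS A)) n :
  200 * automaton_size A + 4000 * (automaton_size A * maxn 1 (size w + n)) +
  300 * automaton_size A + 200 + 200 * (nX A + nbits A) + loop_time w n +
  200 + 100 * ((nD A).+1 * max_vis w n) <=
  100 * 200 * (automaton_size A ^ 2 * bound A * maxn 1 (size w + n)).
Proof.
have d := automaton_dims A; set L := automaton_size A in d *; set m := maxn _ _.
rewrite /loop_time /expand_time -/L /max_vis.
set N := (size w + n).+1; set B := bound A.
have B0 : 1 <= B by rewrite /B /bound prodn_gt0.
have m1 : N <= 2 * m by rewrite /N /m; lia.
have m0 : 1 <= m by rewrite leq_maxl.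
set q := nQ A in d *; set x := nX A in d *; set e := nD A in d *.
set K := L ^ 2 * B * m.
(* The factor 2 absorbs the extra layer: there are |w| + n + 1 of them, at most [2 * m]. *)
have mono y : y <= L ^ 2 -> y * (B * N) <= 2 * K.
  move=> yL; have -> : 2 * K = L ^ 2 * (B * (2 * m)) by rewrite /K; lia.
  by rewrite leq_mul // leq_mul.
have L2 : L <= L ^ 2 by rewrite -mulnn leq_pmulr //; lia.
have K1 : L * m <= K.
  by rewrite /K leq_mul // (leq_trans L2) // leq_pmulr.
have K2 : L <= K by apply: leq_trans K1; rewrite leq_pmulr.
have a1 := mono (q * L); have a2 := mono (x * q * e); have a3 := mono (q * e.+1); have a4 := mono q.
have {}a1 : q * L * (B * N) <= 2 * K by apply: a1; rewrite leq_mul //; lia.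
have {}a2 : x * q * e * (B * N) <= 2 * K by apply: a2; rewrite leq_mul //; lia.
have {}a3 : q * e.+1 * (B * N) <= 2 * K by apply: a3; rewrite leq_mul //; lia.
have {}a4 : q * (B * N) <= 2 * K by apply: a4; apply: leq_trans (leq_pmulr _ _); lia.
have -> : e.+1 * (N * (q * B)) = q * e.+1 * (B * N) by lia.
have -> : (2000 * (L + e * x) + 200) * (N * (q * B)) =
   2000 * (q * L * (B * N)) + 2000 * (x * q * e * (B * N)) + 200 * (q * (B * N)) by lia.
by lia.
Qed.

(* The factor |w| + n is read as max(1, |w| + n): for w empty and n = 0 the
   literal bound would be 0. *)
Theorem mainTheorem9 :
  exists (P : prog) (c : nat),
    forall (A : automaton) (w : seq 'I_(nS A)) (a : 'I_(nS A)) (n : nat),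
      exists (t : nat) (s : memory),
        [/\ exec P (init_memory (instance_code w a n)) t s,
            t <= c * (automaton_size A ^ 2 * bound A * maxn 1 (size w + n)),
            ~ (exists v : seq 'I_(nS A), extension w n v) -> rejects s
          & (exists v : seq 'I_(nS A), extension w n v) ->
            exists v : seq 'I_(nS A), best_extension w a n v /\ outputs s v].
Proof.
exists solver, (100 * 200) => A w a n.
set s0 := init_memory _.
pose query := nat_of_ord a :: n :: map val w.
have := @at_init (instance_code w a n); rewrite /instance_code map_cat at_cat size_map add0n -/s0.
rewrite -/query => -[code_at query_at].
pose zeros := out :: 22 :: 35 :: iota 50 12.
have z0 y : y \in zeros -> s0 y = (fun=> 0) by case: y.
pose R t s := t <= 100 * 200 * (automaton_size A ^ 2 * bound A * maxn 1 (size w + n)) /\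
  (rejects s /\ ~ (exists v, extension w n v) \/ exists v, best_extension w a n v /\ outputs s v).
suff [t [s [ex [tle Rs]]]] : wp solver R 0 s0.
  exists t, s; split=> //; case: Rs => [[r no]|[v [b o]]] ext //; last by exists v.
  by case: ext; exists v; case: b.
have tle := total_time w n; have qle := size_query w a n.
st; apply: (wp_parse_list (x := num) (l := automaton_nats A) (p := 0)) => //.
rewrite add0n -/(automaton_size A) => t1 s1 f1 t1le _ num1 p1.
st; apply: (wp_parse_list (x := wd) (l := query) isT p1) => //.
  by rewrite f1.
move=> t2 s2 f2 t2le tot2 wd2 _; rewrite -/query in qle.
st; apply: (wp_setup (A := A) (w := w) (a := a) (n := n)) => //.
- by rewrite f2.
- by rewrite tot2 /= size_map.
move=> t3 s3 f3 t3le st3.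
have z3 y : y \in zeros -> s3 y = (fun=> 0).
  by move=> yz; rewrite f3 ?f2 ?f1 ?z0 //; apply: mem_off yz.
st; apply: (wp_init_search st3); first exact: z3.
move=> t4 s4 t4le r4; st; apply: (wp_main_loop (r4 _)) => t5 s5 t5le [[_ [fo [so no]]]|f].
  apply: wp_if => /=; rewrite fo //= => _; st; split; first by lia.
  by left; rewrite /rejects so.
apply: (wp_walk (t1 := t5) f) => [|t6 s6 t6le v6]; first by lia.
by split; [lia | right].
Qed.
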